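(* Let $\tau>0$, $z\in\mathbb{R}$ and $m,n\in\mathbb{N}\cup\{0\}$. Then $$F_n(z,\tau)=\frac{e^{\frac{\pi i}{4}-\frac{\pi i z^2}{2\tau}}}{\sqrt{2\tau}}\,F_m\!\left(\tfrac{z}{2\tau},-\tfrac{1}{4\tau}\right)+R_{m,n}(z,\tau),$$ where $$R_{m,n}(z,\tau)=-\frac{i}{2}e^{-\pi i\left(z-\frac{\tau}{2}\right)}\,h\!\left(z-\tau+\tfrac12,-2\tau\right)-\frac{i}{2}(-1)^m e^{2\pi i\left(n+\frac12\right)\left(z+\tau\left(n+\frac12\right)\right)}\,h\!\left(z+(2n+1)\tau-m-\tfrac12,-2\tau\right).$$
   Context: For an integer $n\ge 0$ and real $z,\tau$, the truncated theta function is $F_n(z,\tau):=\sum_{k=0}^n e^{2\pi i(zk+\tau k^2)}$. The Mordell integral is defined for $\tau>0$ and $z\in\mathbb{R}$ by $$h(z,\tau):=2e^{\frac{\pi i}{4}}\int_0^\infty e^{-\pi\tau y^2}\,\frac{\cosh(2\pi z e^{\frac{\pi i}{4}}y)}{\cosh(\pi e^{\frac{\pi i}{4}}y)}\,dy$$ (this is the analytic continuation of $\int_{\mathbb{R}} \frac{e^{\pi i\tau x^2-2\pi zx}}{\cosh(\pi x)}dx$, $\mathrm{Im}\,\tau>0$), and for negative second argument by $h(z,-\tau):=\overline{h(z,\tau)}$ for $\tau>0$, $z\in\mathbb{R}$. *)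

(* Defs.v *)
From Stdlib Require Import Reals.
From Coquelicot Require Import Coquelicot.

Local Open Scope C_scope.

Definition Cexp (w : C) : C :=
  RtoC (exp (Re w)) * (cos (Im w), sin (Im w)).

Definition Ccosh (w : C) : C := (Cexp w + Cexp (- w)) / 2.

(* [sum_n] is inclusive: the sum runs over k = 0, ..., n. *)
Definition F (n : nat) (z tau : R) : C :=
  sum_n (fun k : nat => Cexp (2 * PI * Ci * (z * INR k + tau * INR k ^ 2))) n.

Definition mordell_integrand (z tau y : R) : C :=
  RtoC (exp (- PI * tau * y ^ 2))
  * (Ccosh (2 * PI * z * Cexp (PI * Ci / 4) * y)
     / Ccosh (PI * Cexp (PI * Ci / 4) * y)).

(* Improper Riemann integral over [0, +oo), with C viewed as a complete normed
   module over R. *)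
Definition mordell_pos (z tau : R) : C :=
  2 * Cexp (PI * Ci / 4)
  * RInt_gen (V := C_R_CompleteNormedModule)
      (mordell_integrand z tau) (at_point 0) (Rbar_locally p_infty).

(* Mordell integral for a nonzero real second argument; it is extended to
   tau < 0 by h z tau = conj (h z (- tau)).  The value at tau = 0 is
   irrelevant. *)
Definition h (z tau : R) : C :=
  if Rlt_dec 0 tau then mordell_pos z tau else Cconj (mordell_pos z (- tau)).

Definition Rem (m n : nat) (z tau : R) : C :=
  - (Ci / 2) * Cexp (- (PI * Ci * (z - tau / 2)))
    * h (z - tau + 1 / 2)%R (- 2 * tau)%R
  - (Ci / 2) * (- 1) ^ m
    * Cexp (2 * PI * Ci * (INR n + 1 / 2) * (z + tau * (INR n + 1 / 2)))
    * h (z + (2 * INR n + 1) * tau - INR m - 1 / 2)%R (- 2 * tau)%R.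

(* Main.v *)
Require Import Defs.
From Stdlib Require Import Reals Lra.
From Coquelicot Require Import Coquelicot.

(** With omega = e^(pi i / 4), the Mordell integral is the integral of
    e^(pi i tau x^2 - 2 pi z x) / cosh(pi x) along the line omega R.  It obeys
    two functional equations.  Translating z by 1 cancels the cosh and leaves a
    Gaussian integral.  Translating z by tau amounts to moving the line of
    integration by i, across the pole at i/2, and gives a residue.  The second
    equation is the induction step in n, the first one the induction step in m,
    and the case m = n = 0 combines both.

    The residue theorem is needed only for a parallelogram centred at the pole:
    the integral of f along the boundary scaled by s does not depend on
    s in (0, 1], and as s tends to 0 it approaches the residue times the
    integral of 1/u, which is computed explicitly. *)

Local Open Scope C_scope.

(** * The complex exponential *)

(** Scaling works because the s-derivative of the integral along a side is a difference of values at
    its two ends, and these values cancel at the corners of a closed contour. The long sides of the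
    parallelogram lie on [omega] R and on its translate by i, recentred at the pole; the short sides
    are vertical and contribute nothing in the limit. When the integrand is entire the same scaling
    may be continued down to s = 0, where the contour is a point: this is the form of Cauchy's
    theorem that moves the Gaussian to a parallel line. The theorem involves [h] at -2 tau, so both
    equations are used in conjugated form, for the translations by 1 and by 2 tau. The residue of
    one translation by 2 tau is exactly one new term of [F n], and the Gaussian of one translation
    by 1 is exactly one new term of [F m], up to the common prefactor. For m = n = 0 the arguments z
    - tau + 1/2 and z + tau - 1/2 of the remainder are linked through the intermediate argument z -
    tau - 1/2. *)

Lemma Cexp_plus (a b : C) : Cexp (a + b) = Cexp a * Cexp b.
Proof.
  destruct a as [a1 a2], b as [b1 b2]; unfold Cexp; simpl.
  rewrite exp_plus, cos_plus, sin_plus.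
  apply injective_projections; simpl; ring.
Qed.

Lemma Cexp_0 : Cexp 0 = 1.
Proof.
  unfold Cexp; simpl; rewrite exp_0, cos_0, sin_0.
  apply injective_projections; simpl; ring.
Qed.

Lemma Cmod_Cexp (w : C) : Cmod (Cexp w) = exp (Re w).
Proof.
  unfold Cexp; rewrite Cmod_mult, Cmod_R, Rabs_pos_eq by (left; apply exp_pos).
  replace (Cmod _) with 1%R; [ring|].
  unfold Cmod; simpl; rewrite !Rmult_1_r, Rplus_comm.
  generalize (sin2_cos2 (Im w)); unfold Rsqr; intros ->; now rewrite sqrt_1.
Qed.

Lemma Cexp_neq_0 (w : C) : Cexp w <> 0.
Proof.
  intros H; generalize (Cmod_Cexp w); rewrite H, Cmod_0.
  generalize (exp_pos (Re w)); lra.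
Qed.

Lemma Cexp_opp (w : C) : Cexp (- w) = / Cexp w.
Proof.
  assert (E : Cexp w * Cexp (- w) = 1)
    by (rewrite <- Cexp_plus, <- Cexp_0; f_equal; ring).
  apply (f_equal (fun x => / Cexp w * x)) in E.
  rewrite Cmult_assoc, Cinv_l, Cmult_1_l, Cmult_1_r in E; [exact E|].
  apply Cexp_neq_0.
Qed.

Lemma Cexp_conj (w : C) : Cconj (Cexp w) = Cexp (Cconj w).
Proof.
  destruct w as [a b]; unfold Cexp, Cconj; simpl.
  rewrite cos_neg, sin_neg; apply injective_projections; simpl; ring.
Qed.

Lemma Cexp_RtoC (x : R) : Cexp x = RtoC (exp x).
Proof.
  unfold Cexp; simpl; rewrite cos_0, sin_0.
  apply injective_projections; simpl; ring.
Qed.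

Lemma Cexp_PI : Cexp (PI * Ci) = - (1).
Proof.
  unfold Cexp; simpl.
  replace (PI * 1 + 0 * 0)%R with PI by ring.
  replace (PI * 0 - 0 * 1)%R with 0%R by ring.
  rewrite exp_0, cos_PI, sin_PI; apply injective_projections; simpl; ring.
Qed.

Lemma Cexp_PI2 : Cexp (PI / 2 * Ci) = Ci.
Proof.
  rewrite <- RtoC_div by lra.
  unfold Cexp; simpl.
  replace (PI / 2 * 1 + 0 * 0)%R with (PI / 2)%R by ring.
  replace (PI / 2 * 0 - 0 * 1)%R with 0%R by ring.
  rewrite exp_0, cos_PI2, sin_PI2; apply injective_projections; simpl; ring.
Qed.

Lemma Cexp_nat_PI (k : nat) : Cexp (INR k * (PI * Ci)) = (- (1)) ^ k.
Proof.
  induction k as [|k IH].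
  - simpl; rewrite Cmult_0_l; apply Cexp_0.
  - rewrite S_INR, RtoC_plus, Cmult_plus_distr_r, Cexp_plus, IH, Cmult_1_l, Cexp_PI.
    simpl; ring.
Qed.

Definition omega : C := Cexp (PI * Ci / 4).
Definition rsqrt2 : R := (/ sqrt 2)%R.

Lemma rsqrt2_sqr : (rsqrt2 * rsqrt2 = 1 / 2)%R.
Proof.
  unfold rsqrt2; rewrite <- Rinv_mult, sqrt_sqrt; lra.
Qed.

Lemma rsqrt2_pos : (0 < rsqrt2)%R.
Proof. apply Rinv_0_lt_compat, sqrt_lt_R0; lra. Qed.

Lemma omega_eq : omega = (rsqrt2, rsqrt2).
Proof.
  unfold omega, Cexp, rsqrt2.
  replace (PI * Ci / 4) with (RtoC (PI / 4) * Ci)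
    by (rewrite RtoC_div by lra; field).
  simpl.
  replace (PI / 4 * 1 + 0 * 0)%R with (PI / 4)%R by ring.
  replace (PI / 4 * 0 - 0 * 1)%R with 0%R by ring.
  rewrite exp_0, cos_PI4, sin_PI4; apply injective_projections; simpl; field;
    apply Rgt_not_eq, sqrt_lt_R0; lra.
Qed.

Lemma omega_sqr : omega * omega = Ci.
Proof.
  rewrite omega_eq; apply injective_projections; simpl;
    generalize rsqrt2_sqr; lra.
Qed.

Lemma omega_conj : Cconj omega = - Ci * omega.
Proof.
  rewrite omega_eq; apply injective_projections; simpl; ring.
Qed.

(** * Continuity and differentiation of complex-valued maps by components *)

Section Continuity.

Context {U : UniformSpace}.

Lemma continuous_C (f : U -> C) (x : U) :
  continuous (fun y => Re (f y)) x -> continuous (fun y => Im (f y)) x ->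
  continuous f x.
Proof.
  intros H1 H2 P [e He].
  pose proof (H1 _ (locally_ball (Re (f x)) e)) as A.
  pose proof (H2 _ (locally_ball (Im (f x)) e)) as B.
  refine (filter_imp (F := locally x) _ _ _ (filter_and (F := locally x) _ _ A B)).
  clear A B; intros y [A B].
  apply He; split; [exact A|exact B].
Qed.

Lemma continuous_Re (f : U -> C) (x : U) :
  continuous f x -> continuous (fun y => Re (f y)) x.
Proof.
  intros H P [e He].
  generalize (H _ (locally_ball (f x : C_UniformSpace) e)).
  unfold filtermap; apply filter_imp; intros y [A B]; apply He, A.
Qed.

Lemma continuous_Im (f : U -> C) (x : U) :
  continuous f x -> continuous (fun y => Im (f y)) x.
Proof.
  intros H P [e He].
  generalize (H _ (locally_ball (f x : C_UniformSpace) e)).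
  unfold filtermap; apply filter_imp; intros y [A B]; apply He, B.
Qed.

Lemma continuous_RtoC (f : U -> R) (x : U) :
  continuous f x -> continuous (fun y => RtoC (f y)) x.
Proof.
  intros H; apply continuous_C; simpl; [exact H|apply continuous_const].
Qed.

Lemma continuous_Cplus (f g : U -> C) (x : U) :
  continuous f x -> continuous g x -> continuous (fun y => f y + g y) x.
Proof.
  intros Hf Hg; apply continuous_C; simpl.
  - apply (continuous_plus (V := R_NormedModule) (fun y => Re (f y)) (fun y => Re (g y)));
      now apply continuous_Re.
  - apply (continuous_plus (V := R_NormedModule) (fun y => Im (f y)) (fun y => Im (g y)));
      now apply continuous_Im.
Qed.

Lemma continuous_Cmult (f g : U -> C) (x : U) :
  continuous f x -> continuous g x -> continuous (fun y => f y * g y) x.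
Proof.
  intros Hf Hg.
  pose proof (continuous_Re _ _ Hf); pose proof (continuous_Im _ _ Hf);
  pose proof (continuous_Re _ _ Hg); pose proof (continuous_Im _ _ Hg).
  apply continuous_C; simpl.
  - apply (continuous_minus (V := R_NormedModule)
      (fun y => Re (f y) * Re (g y))%R (fun y => Im (f y) * Im (g y))%R);
    now apply @continuous_mult.
  - apply (continuous_plus (V := R_NormedModule)
      (fun y => Re (f y) * Im (g y))%R (fun y => Im (f y) * Re (g y))%R);
    now apply @continuous_mult.
Qed.

Lemma continuous_Cexp (f : U -> C) (x : U) :
  continuous f x -> continuous (fun y => Cexp (f y)) x.
Proof.
  intros Hf.
  pose proof (continuous_Re _ _ Hf) as H1; pose proof (continuous_Im _ _ Hf) as H2.
  apply continuous_Cmult.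
  - apply continuous_RtoC, (continuous_comp (fun y => Re (f y)) exp); [exact H1|].
    apply continuity_pt_filterlim, derivable_continuous_pt, derivable_pt_exp.
  - apply continuous_C; simpl.
    + apply (continuous_comp (fun y => Im (f y)) cos); [exact H2|].
      apply continuity_pt_filterlim, continuity_cos.
    + apply (continuous_comp (fun y => Im (f y)) sin); [exact H2|].
      apply continuity_pt_filterlim, continuity_sin.
Qed.

Lemma continuous_Cinv (f : U -> C) (x : U) :
  f x <> 0 -> continuous f x -> continuous (fun y => / f y) x.
Proof.
  intros H0 Hf.
  pose proof (continuous_Re _ _ Hf) as H1; pose proof (continuous_Im _ _ Hf) as H2.
  assert (HN : continuous (fun y => / (Re (f y) ^ 2 + Im (f y) ^ 2))%R x).
  { apply (continuous_comp (fun y => Re (f y) ^ 2 + Im (f y) ^ 2)%R Rinv).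
    - apply (continuous_plus (V := R_NormedModule)
        (fun y => Re (f y) ^ 2)%R (fun y => Im (f y) ^ 2)%R).
      + apply (continuous_comp (fun y => Re (f y)) (fun t => t ^ 2)%R); [exact H1|].
        apply continuity_pt_filterlim, derivable_continuous_pt, derivable_pt_pow.
      + apply (continuous_comp (fun y => Im (f y)) (fun t => t ^ 2)%R); [exact H2|].
        apply continuity_pt_filterlim, derivable_continuous_pt, derivable_pt_pow.
    - apply continuous_Rinv; intros E; apply H0.
      apply Cmod_eq_0; unfold Cmod; unfold Re, Im in E; rewrite E; apply sqrt_0. }
  apply continuous_C; simpl.
  - now apply @continuous_mult.
  - apply @continuous_mult; [|exact HN].
    now apply (continuous_opp (V := R_NormedModule) (fun y => Im (f y))).
Qed.

End Continuity.

Section CurveDerivative.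

Lemma is_derive_C (f : R -> C) (t : R) (l : C) :
  is_derive (fun s => Re (f s)) t (Re l) -> is_derive (fun s => Im (f s)) t (Im l) ->
  is_derive (V := C_R_NormedModule) f t l.
Proof.
  intros H1 H2.
  apply (is_derive_ext (V := C_R_NormedModule)
    (fun s => plus (scal (Re (f s)) ((1, 0)%R : C)) (scal (Im (f s)) ((0, 1)%R : C)))).
  { intros s; destruct (f s) as [u v]; apply injective_projections;
      unfold plus, scal; simpl; unfold plus, scal, mult; simpl; unfold mult; simpl; ring. }
  replace l with (plus (scal (Re l) ((1, 0)%R : C_R_NormedModule))
                       (scal (Im l) ((0, 1)%R : C_R_NormedModule)))
    by (destruct l as [u v]; apply injective_projections;
      unfold plus, scal; simpl; unfold plus, scal, mult; simpl; unfold mult; simpl; ring).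
  apply (is_derive_plus (V := C_R_NormedModule)); now apply @is_derive_scal_l.
Qed.

Lemma is_derive_Re (f : R -> C) (t : R) (l : C) :
  is_derive (V := C_R_NormedModule) f t l -> is_derive (fun s => Re (f s)) t (Re l).
Proof.
  intros H.
  exact (filterdiff_comp' f fst t _ fst H (filterdiff_linear fst is_linear_fst)).
Qed.

Lemma is_derive_Im (f : R -> C) (t : R) (l : C) :
  is_derive (V := C_R_NormedModule) f t l -> is_derive (fun s => Im (f s)) t (Im l).
Proof.
  intros H.
  exact (filterdiff_comp' f snd t _ snd H (filterdiff_linear snd is_linear_snd)).
Qed.

Lemma is_derive_Cplus (f g : R -> C) (t : R) (lf lg : C) :
  is_derive (V := C_R_NormedModule) f t lf -> is_derive (V := C_R_NormedModule) g t lg ->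
  is_derive (V := C_R_NormedModule) (fun s => f s + g s) t (lf + lg).
Proof. exact (is_derive_plus (V := C_R_NormedModule) f g t lf lg). Qed.

Lemma is_derive_Cmult (f g : R -> C) (t : R) (lf lg : C) :
  is_derive (V := C_R_NormedModule) f t lf -> is_derive (V := C_R_NormedModule) g t lg ->
  is_derive (V := C_R_NormedModule) (fun s => f s * g s) t (lf * g t + f t * lg).
Proof.
  intros Hf Hg.
  pose proof (is_derive_Re _ _ _ Hf); pose proof (is_derive_Im _ _ _ Hf);
  pose proof (is_derive_Re _ _ _ Hg); pose proof (is_derive_Im _ _ _ Hg).
  assert (M : forall (u v : R -> R) lu lv, is_derive u t lu -> is_derive v t lv ->
    is_derive (fun s => u s * v s)%R t (lu * v t + u t * lv)%R)
    by (intros; apply (is_derive_mult u v); auto; apply Rmult_comm).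
  apply is_derive_C.
  - apply (is_derive_ext (fun s => Re (f s) * Re (g s) - Im (f s) * Im (g s))%R);
      [reflexivity|].
    replace (Re _) with
      ((Re lf * Re (g t) + Re (f t) * Re lg) - (Im lf * Im (g t) + Im (f t) * Im lg))%R
      by (simpl; unfold Re, Im; ring).
    apply @is_derive_minus; now apply M.
  - apply (is_derive_ext (fun s => Re (f s) * Im (g s) + Im (f s) * Re (g s))%R);
      [reflexivity|].
    replace (Im _) with
      ((Re lf * Im (g t) + Re (f t) * Im lg) + (Im lf * Re (g t) + Im (f t) * Re lg))%R
      by (simpl; unfold Re, Im; ring).
    apply @is_derive_plus; now apply M.
Qed.

Lemma is_derive_Cexp (f : R -> C) (t : R) (l : C) :
  is_derive (V := C_R_NormedModule) f t l ->
  is_derive (V := C_R_NormedModule) (fun s => Cexp (f s)) t (Cexp (f t) * l).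
Proof.
  intros Hf.
  pose proof (is_derive_Re _ _ _ Hf) as H1; pose proof (is_derive_Im _ _ _ Hf) as H2.
  replace (Cexp (f t) * l) with
    (RtoC (Re l * exp (Re (f t)))%R * (cos (Im (f t)), sin (Im (f t)))
     + RtoC (exp (Re (f t))) * ((Im l * - sin (Im (f t)))%R, (Im l * cos (Im (f t)))%R))
    by (unfold Cexp; apply injective_projections; simpl; unfold Re, Im; ring).
  apply (is_derive_Cmult (fun s => RtoC (exp (Re (f s))))
                         (fun s => (cos (Im (f s)), sin (Im (f s))))).
  - apply is_derive_C; simpl.
    + apply (is_derive_comp exp (fun s => Re (f s))); [|exact H1].
      apply is_derive_Reals, derivable_pt_lim_exp.
    + apply @is_derive_const.
  - apply is_derive_C; simpl.
    + apply (is_derive_comp cos (fun s => Im (f s))); [|exact H2].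
      apply is_derive_Reals, derivable_pt_lim_cos.
    + apply (is_derive_comp sin (fun s => Im (f s))); [|exact H2].
      apply is_derive_Reals, derivable_pt_lim_sin.
Qed.

Lemma is_derive_Cinv (f : R -> C) (t : R) (l : C) :
  f t <> 0 -> is_derive (V := C_R_NormedModule) f t l ->
  is_derive (V := C_R_NormedModule) (fun s => / f s) t (- (l / (f t * f t))).
Proof.
  intros H0 Hf.
  pose proof (is_derive_Re _ _ _ Hf) as H1; pose proof (is_derive_Im _ _ _ Hf) as H2.
  assert (HN : (Re (f t) * Re (f t) + Im (f t) * Im (f t) <> 0)%R).
  { intros E; apply H0, Cmod_eq_0; unfold Cmod; unfold Re, Im in E.
    rewrite <- sqrt_0; f_equal; rewrite <- E; ring. }
  (* The real part of the inverse is u / (u^2 + v^2), and the imaginary part is minus the same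
     expression with u and v exchanged, so one real computation serves both. *)
  assert (K : forall (u v : R -> R) lu lv,
    is_derive u t lu -> is_derive v t lv -> (u t * u t + v t * v t <> 0)%R ->
    is_derive (fun s => u s / (u s ^ 2 + v s ^ 2))%R t
      ((lu * (v t * v t - u t * u t) - 2 * u t * v t * lv)
        / (u t * u t + v t * v t) ^ 2)%R).
  { intros u v lu lv Hu Hv Huv; evar_last.
    - auto_derive; [|reflexivity].
      repeat split; try (now exists lu); try (now exists lv).
      now rewrite !Rmult_1_r.
    - change (Derive (fun s => u s) t) with (Derive u t).
      change (Derive (fun s => v s) t) with (Derive v t).
      rewrite (is_derive_unique _ _ _ Hu), (is_derive_unique _ _ _ Hv).
      field; repeat split; nra. }
  apply is_derive_C.
  - apply (is_derive_ext (fun s => Re (f s) / (Re (f s) ^ 2 + Im (f s) ^ 2))%R);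
      [reflexivity|].
    replace (Re _) with
      ((Re l * (Im (f t) * Im (f t) - Re (f t) * Re (f t))
         - 2 * Re (f t) * Im (f t) * Im l)
        / (Re (f t) * Re (f t) + Im (f t) * Im (f t)) ^ 2)%R
      by (simpl; unfold Re, Im in *; field; repeat split; nra).
    now apply K.
  - apply (is_derive_ext (fun s => - (Im (f s) / (Im (f s) ^ 2 + Re (f s) ^ 2)))%R).
    { intros s; simpl; unfold Re, Im, Rdiv; rewrite Ropp_mult_distr_l; do 2 f_equal; ring. }
    replace (Im _) with
      (- ((Im l * (Re (f t) * Re (f t) - Im (f t) * Im (f t))
         - 2 * Im (f t) * Re (f t) * Re l)
        / (Im (f t) * Im (f t) + Re (f t) * Re (f t)) ^ 2))%R
      by (simpl; unfold Re, Im in *; field; repeat split; nra).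
    apply @is_derive_opp, K; [assumption..|].
    now rewrite Rplus_comm.
Qed.

End CurveDerivative.

(** * Integrals along scaled segments *)

(* [ring] and [field] do not recognise the carriers of the Coquelicot
   structures on C. *)
Ltac to_C := match goal with |- ?a = ?b => change (@eq C a b) end; cbv beta.
Ltac Cring := to_C; ring.
Ltac Cfield := to_C; field.

Notation CRInt := (RInt (V := C_R_CompleteNormedModule)).
Notation is_CRInt := (is_RInt (V := C_R_NormedModule)).
Notation is_Cderive := (is_derive (K := R_AbsRing) (V := C_R_NormedModule)).

Lemma ex_CRInt (f : R -> C) (a b : R) :
  (forall y, continuous f y) -> ex_RInt (V := C_R_NormedModule) f a b.
Proof.
  intros H; apply (ex_RInt_continuous (V := C_R_CompleteNormedModule)); intros y _; apply H.
Qed.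

Lemma CRInt_correct (f : R -> C) (a b : R) :
  (forall y, continuous f y) -> is_CRInt f a b (CRInt f a b).
Proof.
  intros H; apply (RInt_correct (V := C_R_CompleteNormedModule)), ex_CRInt, H.
Qed.

Lemma is_CRInt_unique (f : R -> C) (a b : R) (l : C) :
  is_CRInt f a b l -> CRInt f a b = l.
Proof. apply (is_RInt_unique (V := C_R_CompleteNormedModule)). Qed.

Lemma Re_CRInt (f : R -> C) (a b : R) :
  (forall y, continuous f y) -> Re (CRInt f a b) = RInt (fun y => Re (f y)) a b.
Proof.
  intros H; symmetry; apply is_RInt_unique.
  exact (is_RInt_fct_extend_fst _ _ _ _ (CRInt_correct f a b H)).
Qed.

Lemma Im_CRInt (f : R -> C) (a b : R) :
  (forall y, continuous f y) -> Im (CRInt f a b) = RInt (fun y => Im (f y)) a b.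
Proof.
  intros H; symmetry; apply is_RInt_unique.
  exact (is_RInt_fct_extend_snd _ _ _ _ (CRInt_correct f a b H)).
Qed.

Lemma is_CRInt_mult_l (c : C) (f : R -> C) (a b : R) (l : C) :
  is_CRInt f a b l -> is_CRInt (fun y => c * f y) a b (c * l).
Proof.
  intros H.
  pose proof (is_RInt_fct_extend_fst _ _ _ _ H) as H1.
  pose proof (is_RInt_fct_extend_snd _ _ _ _ H) as H2.
  apply (is_RInt_fct_extend_pair (U := R_NormedModule) (V := R_NormedModule)).
  - apply (is_RInt_minus (V := R_NormedModule));
      now apply (is_RInt_scal (V := R_NormedModule)).
  - apply (is_RInt_plus (V := R_NormedModule));
      now apply (is_RInt_scal (V := R_NormedModule)).
Qed.

Lemma Cmod_CRInt_le (f : R -> C) (a b M : R) :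
  (a <= b)%R -> (forall y, continuous f y) ->
  (forall y, (a <= y <= b)%R -> (Cmod (f y) <= M)%R) ->
  (Cmod (CRInt f a b) <= (b - a) * M)%R.
Proof.
  intros Hab Hc HM; rewrite Cmod_norm.
  apply (norm_RInt_le_const f a b); auto using CRInt_correct.
  intros y Hy; rewrite <- Cmod_norm; auto.
Qed.

(** A conservation law: differentiation under the integral sign produces the integral of [D s0], and
    [D s0] is also the y-derivative of [B s0], so only boundary values of [B s0] survive. *)
Lemma is_derive_RInt_conservation (A B D : R -> R -> R) (a b s0 e : R) :
  (0 < e)%R ->
  (forall s y, (Rabs (s - s0) < e)%R -> is_derive (fun s => A s y) s (D s y)) ->
  (forall y, is_derive (B s0) y (D s0 y)) ->
  (forall y, continuous (fun z : R * R => D (fst z) (snd z)) (s0, y)) ->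
  (forall s y, (Rabs (s - s0) < e)%R -> continuous (A s) y) ->
  is_derive (fun s => RInt (A s) a b) s0 (B s0 b - B s0 a)%R.
Proof.
  intros He HA HB HD Hc.
  assert (HL : locally s0 (fun s => (Rabs (s - s0) < e)%R))
    by (exists (mkposreal e He); intros s Hs; exact Hs).
  assert (H0 : (Rabs (s0 - s0) < e)%R)
    by (rewrite Rminus_diag_eq, Rabs_R0 by reflexivity; exact He).
  evar_last.
  - apply is_derive_RInt_param.
    + revert HL; apply filter_imp; intros s Hs t _; exists (D s t); auto.
    + intros t _; apply continuity_2d_pt_ext_loc with D.
      * exists (mkposreal e He); simpl; intros u v Hu _.
        symmetry; apply is_derive_unique; auto.
      * apply continuity_2d_pt_filterlim, HD.
    + revert HL; apply filter_imp; intros s Hs.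
      apply (ex_RInt_continuous (V := R_CompleteNormedModule)); auto.
  - rewrite (RInt_ext _ (D s0)).
    + apply is_RInt_unique, (is_RInt_derive (V := R_CompleteNormedModule) (B s0)); auto.
      intros y _.
      apply (continuous_comp (fun y : R => (s0, y)) (fun z => D (fst z) (snd z))); auto.
      intros P [d0 Hd]; exists d0; intros u Hu; apply Hd; split; [apply ball_center|exact Hu].
    + intros y _; apply is_derive_unique; auto.
Qed.

(** Differentiability is stated as the chain rule along real curves through [u], because f is
    differentiated only along such curves: in the scale s and in the parameter y of a side.
    Continuity of [f'] is what differentiation under the integral requires. *)
Definition holo (f f' : C -> C) (u : C) : Prop :=
  continuous f u /\ continuous f' u /\
  forall (g : R -> C) (t : R) (l : C),
    g t = u -> is_Cderive g t l -> is_Cderive (fun s => f (g s)) t (f' u * l).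

Definition line (f : C -> C) (p q : C) (a b : R) : C :=
  CRInt (fun y : R => f (p + q * y) * q) a b.

Ltac Ccont :=
  try assumption;
  lazymatch goal with
  | |- continuous (fun _ => ?c) _ => apply continuous_const
  | |- continuous (fun y => y) _ => apply continuous_id
  | |- continuous fst _ => apply continuous_fst
  | |- continuous snd _ => apply continuous_snd
  | |- continuous (fun y => fst y) _ => apply continuous_fst
  | |- continuous (fun y => snd y) _ => apply continuous_snd
  | |- continuous (fun y => Cplus _ _) _ => apply continuous_Cplus; Ccont
  | |- continuous (fun y => Cmult _ _) _ => apply continuous_Cmult; Ccont
  | |- continuous (fun y => RtoC _) _ => apply continuous_RtoC; Ccont
  | |- continuous RtoC _ => apply (continuous_RtoC (fun y => y)), continuous_id
  | |- _ => idtac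
  end.

Lemma continuous_line (f : C -> C) (p q : C) (y : R) :
  continuous f (p + q * y) -> continuous (fun y : R => f (p + q * y) * q) y.
Proof.
  intros H; apply continuous_Cmult; [|Ccont].
  apply (continuous_comp (fun y : R => p + q * y) f); Ccont.
Qed.

Lemma is_derive_RtoC (t : R) : is_Cderive RtoC t (RtoC 1).
Proof.
  apply is_derive_C; simpl; [apply (is_derive_id (K := R_AbsRing))|apply @is_derive_const].
Qed.

Lemma is_derive_Cconst (c : C) (t : R) : is_Cderive (fun _ => c) t (RtoC 0).
Proof. exact (is_derive_const (K := R_AbsRing) (V := C_R_NormedModule) c t). Qed.

(* d/ds [f(s w) s w'] = d/dy [f(s w) w] for w = p + q y, so the s-derivative
   of the integral along a scaled segment is a boundary term. *)
Lemma is_derive_line_scale (f f' : C -> C) (p q : C) (a b s0 e : R) :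
  (0 < e)%R ->
  (forall s y : R, (Rabs (s - s0) < e)%R -> holo f f' (s * (p + q * y))) ->
  is_Cderive (fun s : R => line f (s * p) (s * q) a b) s0
    (f (s0 * (p + q * b)) * (p + q * b) - f (s0 * (p + q * a)) * (p + q * a)).
Proof.
  intros He H.
  assert (H0 : (Rabs (s0 - s0) < e)%R)
    by (rewrite Rminus_diag_eq, Rabs_R0 by reflexivity; exact He).
  set (A := fun s y : R => f (s * p + s * q * y) * (s * q)).
  set (B := fun s y : R => f (s * (p + q * y)) * (p + q * y)).
  set (D := fun s y : R =>
    f' (s * (p + q * y)) * (p + q * y) * (s * q) + f (s * (p + q * y)) * q).
  assert (E : forall s y : R, s * p + s * q * y = s * (p + q * y)) by (intros; ring).
  assert (HA : forall s y, (Rabs (s - s0) < e)%R ->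
    is_Cderive (fun s => A s y) s (D s y)).
  { intros s y Hs; unfold A.
    evar_last.
    - apply is_derive_Cmult.
      + apply (proj2 (proj2 (H s y Hs)) (fun s : R => s * p + s * q * y)); [apply E|].
        apply (is_derive_Cplus (fun s : R => s * p) (fun s : R => s * q * y));
        apply is_derive_Cmult.
        * apply is_derive_RtoC.
        * apply is_derive_Cconst.
        * apply is_derive_Cmult; [apply is_derive_RtoC|apply is_derive_Cconst].
        * apply is_derive_Cconst.
      + apply is_derive_Cmult; [apply is_derive_RtoC|apply is_derive_Cconst].
    - unfold D; rewrite E; ring. }
  assert (HB : forall y, is_Cderive (B s0) y (D s0 y)).
  { intros y; unfold B.
    assert (HL : is_Cderive (fun y : R => p + q * y) y q).
    { evar_last.
      - apply is_derive_Cplus; [apply is_derive_Cconst|].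
        apply is_derive_Cmult; [apply is_derive_Cconst|apply is_derive_RtoC].
      - Cring. }
    evar_last.
    - apply is_derive_Cmult; [|exact HL].
      apply (proj2 (proj2 (H s0 y H0)) (fun y : R => s0 * (p + q * y))); [reflexivity|].
      apply is_derive_Cmult; [apply is_derive_Cconst|exact HL].
    - unfold D; Cring. }
  assert (Hc : forall s y, (Rabs (s - s0) < e)%R -> continuous (A s) y).
  { intros s y Hs; apply continuous_line; rewrite E; apply (H s y Hs). }
  assert (HD : forall y, continuous (fun z : R * R => D (fst z) (snd z)) (s0, y)).
  { intros y; destruct (H s0 y H0) as [C0 [C1 _]]; unfold D.
    assert (HL : continuous (fun z : R * R => p + q * snd z) (s0, y)) by Ccont.
    assert (HS : continuous (fun z : R * R => fst z * (p + q * snd z)) (s0, y)) by Ccont.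
    Ccont.
    - now apply (continuous_comp (fun z : R * R => fst z * (p + q * snd z)) f').
    - now apply (continuous_comp (fun z : R * R => fst z * (p + q * snd z)) f). }
  assert (HN : locally s0 (fun s => (Rabs (s - s0) < e)%R))
    by (exists (mkposreal e He); intros s Hs; exact Hs).
  apply is_derive_C.
  - apply (is_derive_ext_loc (fun s => RInt (fun y => Re (A s y)) a b)).
    { revert HN; apply filter_imp; intros s Hs; symmetry.
      apply (Re_CRInt (A s)); intros y; apply Hc, Hs. }
    apply (is_derive_RInt_conservation (fun s y => Re (A s y)) (fun s y => Re (B s y))
             (fun s y => Re (D s y)) a b s0 e He).
    + intros; now apply is_derive_Re, HA.
    + intros; now apply is_derive_Re.
    + intros; now apply continuous_Re.
    + intros; now apply continuous_Re, Hc.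
  - apply (is_derive_ext_loc (fun s => RInt (fun y => Im (A s y)) a b)).
    { revert HN; apply filter_imp; intros s Hs; symmetry.
      apply (Im_CRInt (A s)); intros y; apply Hc, Hs. }
    apply (is_derive_RInt_conservation (fun s y => Im (A s y)) (fun s y => Im (B s y))
             (fun s y => Im (D s y)) a b s0 e He).
    + intros; now apply is_derive_Im, HA.
    + intros; now apply is_derive_Im.
    + intros; now apply continuous_Im.
    + intros; now apply continuous_Im, Hc.
Qed.

(** The integral of [f] along the closed parallelogram with corners s (p - qY), s (p + qY), s (p +
    qY + r), s (p - qY + r), in this order. *)
Definition quad (f : C -> C) (p q r : C) (Y s : R) : C :=
  line f (s * p) (s * q) (- Y) Y + line f (s * (p + q * Y)) (s * r) 0 1
  - line f (s * (p + r)) (s * q) (- Y) Y - line f (s * (p - q * Y)) (s * r) 0 1.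

(** The whole lines carrying the four sides, not just the segments: the integrands are then
    continuous for every real y, and no range condition has to be carried along. *)
Definition on_sides (p q r : C) (Y : R) (w : C) : Prop :=
  exists y : R, w = p + q * y \/ w = p + r + q * y
    \/ w = p + q * Y + r * y \/ w = p - q * Y + r * y.

(** Each side contributes to the s-derivative the values of f(s w) w at its ends, and every corner
    belongs to two sides with opposite signs. The bound 2 leaves room beyond s = 1, where the
    derivative is needed as well; [l] is 0 if there is a pole at the centre and -1 for an entire
    function. *)
Lemma quad_scale (f f' : C -> C) (p q r : C) (Y l : R) :
  (forall (s : R) (w : C), (l < s < 2)%R -> on_sides p q r Y w -> holo f f' (s * w)) ->
  forall s : R, (l < s < 1)%R -> quad f p q r Y s = quad f p q r Y 1.
Proof.
  intros H s1 Hs1.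
  apply (eq_is_derive (V := C_R_NormedModule) (quad f p q r Y)); [|lra].
  intros s Hs.
  set (e := Rmin (s - l) (2 - s)).
  assert (He : (0 < e)%R) by (apply Rmin_glb_lt; lra).
  assert (Hnear : forall s', (Rabs (s' - s) < e)%R -> (l < s' < 2)%R).
  { intros s' Hs'; apply Rabs_def2 in Hs'.
    pose proof (Rmin_l (s - l) (2 - s)); pose proof (Rmin_r (s - l) (2 - s)).
    unfold e in Hs'; lra. }
  assert (D : forall P Q a b, (forall y : R, on_sides p q r Y (P + Q * y)) ->
    is_Cderive (fun s : R => line f (s * P) (s * Q) a b) s
      (f (s * (P + Q * b)) * (P + Q * b) - f (s * (P + Q * a)) * (P + Q * a))).
  { intros P Q a b HW; apply (is_derive_line_scale f f' P Q a b s e He).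
    intros s' y Hs'; apply H; auto. }
  evar_last.
  - apply (is_derive_minus (V := C_R_NormedModule));
      [apply (is_derive_minus (V := C_R_NormedModule));
        [apply (is_derive_plus (V := C_R_NormedModule))|]|];
      apply D; intros y; exists y; auto.
  - match goal with |- ?a = _ => change a with
      (f (s * (p + q * Y)) * (p + q * Y) - f (s * (p + q * (- Y)%R)) * (p + q * (- Y)%R)
       + (f (s * (p + q * Y + r * 1)) * (p + q * Y + r * 1)
          - f (s * (p + q * Y + r * 0)) * (p + q * Y + r * 0))
       - (f (s * (p + r + q * Y)) * (p + r + q * Y)
          - f (s * (p + r + q * (- Y)%R)) * (p + r + q * (- Y)%R))
       - (f (s * (p - q * Y + r * 1)) * (p - q * Y + r * 1)
          - f (s * (p - q * Y + r * 0)) * (p - q * Y + r * 0))) end.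
    rewrite RtoC_opp.
    replace (p + q * Y + r * 1) with (p + r + q * Y) by ring.
    replace (p + q * Y + r * 0) with (p + q * Y) by ring.
    replace (p - q * Y + r * 1) with (p + r + q * - Y) by ring.
    replace (p - q * Y + r * 0) with (p + q * - Y) by ring.
    change (@zero _) with (RtoC 0); Cring.
Qed.

Lemma holo_inv (u : C) : u <> 0 -> holo Cinv (fun u => - (/ (u * u))) u.
Proof.
  intros Hu; split; [|split].
  - apply (continuous_Cinv (fun u => u)); [exact Hu|apply continuous_id].
  - apply (continuous_ext (fun u => - (1) * / (u * u))); [intros; Cring|].
    apply continuous_Cmult; [apply continuous_const|].
    apply (continuous_Cinv (fun u : C_UniformSpace => u * u)).
    + now apply Cmult_neq_0.
    + apply continuous_Cmult; apply continuous_id.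
  - intros g t l Hg Hl; evar_last; [apply is_derive_Cinv; [now rewrite Hg|exact Hl]|].
    rewrite Hg; now Cfield.
Qed.

(** Near a simple pole f(s w) is close to rho / (s w), uniformly for w on the segment, since there
    [Cmod w] is bounded above and at least [m]. *)
Lemma line_scale_residue (f f' : C -> C) (rho p q : C) (a b m : R) :
  (a <= b)%R -> (0 < m)%R -> (forall y : R, (m <= Cmod (p + q * y))%R) ->
  (forall s y : R, (0 < s < 2)%R -> holo f f' (s * (p + q * y))) ->
  (forall e : R, (0 < e)%R -> exists dl : R, (0 < dl)%R /\
    forall u : C, u <> 0 -> (Cmod u < dl)%R -> (Cmod (u * f u - rho) <= e)%R) ->
  forall e : R, (0 < e)%R -> at_right 0 (fun s : R =>
    (Cmod (line f (s * p) (s * q) a b - rho * line Cinv (s * p) (s * q) a b) <= e)%R).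
Proof.
  intros Hab Hm Hw Hf Hrho e He.
  (* Length of the parameter interval times the bound for |q / w|; the added 1 keeps [K] positive
     even when this product vanishes. *)
  set (K := ((b - a) * (Cmod q / m) + 1)%R).
  assert (Hq : (0 <= Cmod q / m)%R)
    by (apply Rmult_le_pos; [apply Cmod_ge_0|left; now apply Rinv_0_lt_compat]).
  assert (HK : (0 < K)%R) by (unfold K; nra).
  destruct (Hrho (e / K)%R) as [dl [Hdl HR]]; [now apply Rdiv_lt_0_compat|].
  (* [B] exceeds |p + q y| for y between a and b, so s < dl / B places the whole scaled segment
     inside the disc of radius dl. *)
  set (B := (Cmod p + Cmod q * (Rabs a + Rabs b) + 1)%R).
  assert (HB : (0 < B)%R).
  { unfold B; pose proof (Cmod_ge_0 p); pose proof (Cmod_ge_0 q).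
    pose proof (Rabs_pos a); pose proof (Rabs_pos b); nra. }
  assert (Hd : (0 < Rmin 1 (dl / B))%R)
    by (apply Rmin_glb_lt; [lra|now apply Rdiv_lt_0_compat]).
  exists (mkposreal _ Hd); intros s Hs Hs0.
  assert (Hs1 : (s < Rmin 1 (dl / B))%R).
  { change (Rabs (s - 0) < Rmin 1 (dl / B))%R in Hs.
    rewrite Rminus_0_r, Rabs_pos_eq in Hs; lra. }
  assert (Hs2 : (0 < s < 2)%R) by (pose proof (Rmin_l 1 (dl / B)); lra).
  assert (Hs3 : (s * B < dl)%R).
  { apply Rlt_le_trans with (dl / B * B)%R; [|right; field; lra].
    apply Rmult_lt_compat_r; [exact HB|].
    apply Rlt_le_trans with (1 := Hs1), Rmin_r. }
  assert (E : forall y : R, s * p + s * q * y = s * (p + q * y)) by (intros; ring).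
  assert (Hn : forall y : R, s * (p + q * y) <> 0).
  { intros y Hy; pose proof (Cmod_mult s (p + q * y)) as HM.
    rewrite Hy, Cmod_0, Cmod_R, Rabs_pos_eq in HM by lra.
    specialize (Hw y); nra. }
  assert (C1 : forall y : R, continuous (fun y : R => f (s * p + s * q * y) * (s * q)) y)
    by (intros y; apply continuous_line; rewrite E; now apply Hf).
  assert (C2 : forall y : R, continuous (fun y : R => / (s * p + s * q * y) * (s * q)) y)
    by (intros y; apply continuous_line; rewrite E; apply (holo_inv _ (Hn y))).
  unfold line.
  rewrite <- (is_CRInt_unique _ a b _ (is_CRInt_mult_l rho _ _ _ _ (CRInt_correct _ a b C2))).
  pose proof (is_RInt_minus (V := C_R_NormedModule) _ _ _ _ _ _ (CRInt_correct _ a b C1)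
    (is_CRInt_mult_l rho _ _ _ _ (CRInt_correct _ a b C2))) as HI.
  rewrite (is_CRInt_unique _ _ _ _ (is_CRInt_mult_l rho _ _ _ _ (CRInt_correct _ a b C2))).
  apply is_CRInt_unique in HI.
  match goal with |- (Cmod ?x <= _)%R => change x with
    (minus (G := C_R_NormedModule)
       (CRInt (fun y : R => f (s * p + s * q * y) * (s * q)) a b)
       (rho * CRInt (fun y : R => / (s * p + s * q * y) * (s * q)) a b)) end.
  rewrite <- HI.
  apply Rle_trans with ((b - a) * (e / K * (Cmod q / m)))%R.
  - apply Cmod_CRInt_le; [exact Hab| |].
    + intros y; apply (continuous_minus (V := C_R_NormedModule)); [apply C1|].
      apply continuous_Cmult; [apply continuous_const|apply C2].
    + intros y Hy.
      match goal with |- (Cmod ?x <= _)%R => change x with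
        (f (s * p + s * q * y) * (s * q) - rho * (/ (s * p + s * q * y) * (s * q))) end.
      rewrite E.
      assert (Hs' : RtoC s <> 0) by (intros H; apply RtoC_inj in H; lra).
      assert (Hwn : p + q * y <> 0)
        by (intros H; apply (Hn y); rewrite H; ring).
      (* The factor s of the scaled side cancels the 1/s of the pole: what is left is the error u
         f(u) - rho at u = s w, times q / w. *)
      replace (f (s * (p + q * y)) * (s * q) - rho * (/ (s * (p + q * y)) * (s * q)))
        with ((s * (p + q * y) * f (s * (p + q * y)) - rho) * (q / (p + q * y)))
        by (field; auto).
      rewrite Cmod_mult, Cmod_div by exact Hwn.
      apply Rmult_le_compat; try apply Cmod_ge_0.
      * apply Rmult_le_pos; [apply Cmod_ge_0|].
        left; apply Rinv_0_lt_compat; specialize (Hw y); lra.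
      * apply HR; [apply Hn|].
        rewrite Cmod_mult, Cmod_R, Rabs_pos_eq by lra.
        apply Rle_lt_trans with (2 := Hs3), Rmult_le_compat_l; [lra|].
        apply Rle_trans with (1 := Cmod_triangle _ _).
        rewrite Cmod_mult, Cmod_R; unfold B.
        assert (Rabs y <= Rabs a + Rabs b)%R.
        { unfold Rabs; destruct (Rcase_abs y), (Rcase_abs a), (Rcase_abs b); lra. }
        pose proof (Cmod_ge_0 q); nra.
      * apply Rmult_le_compat_l; [apply Cmod_ge_0|apply Rinv_le_contravar; auto].
  - replace ((b - a) * (e / K * (Cmod q / m)))%R
      with (e * (((b - a) * (Cmod q / m)) / K))%R by (field; lra).
    rewrite <- (Rmult_1_r e) at 2; apply Rmult_le_compat_l; [lra|].
    apply Rle_div_l; [exact HK|unfold K; lra].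
Qed.

Lemma Cminus_eq_0 (a b : C) : a - b = 0 -> a = b.
Proof. intros H; replace a with (a - b + b) by ring; rewrite H; ring. Qed.

Lemma quad_residue (f f' : C -> C) (rho p q r : C) (Y m : R) :
  (0 <= Y)%R -> (0 < m)%R ->
  (forall w : C, on_sides p q r Y w -> (m <= Cmod w)%R) ->
  (forall (s : R) (w : C), (0 < s < 2)%R -> on_sides p q r Y w -> holo f f' (s * w)) ->
  (forall e : R, (0 < e)%R -> exists dl : R, (0 < dl)%R /\
    forall u : C, u <> 0 -> (Cmod u < dl)%R -> (Cmod (u * f u - rho) <= e)%R) ->
  quad f p q r Y 1 = rho * quad Cinv p q r Y 1.
Proof.
  intros HY Hm Hw Hf Hrho.
  (* The integral of 1/u is itself independent of s, so both integrals can be compared at one small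
     s and then carried back to s = 1. *)
  assert (Hi : forall (s : R) (w : C), (0 < s < 2)%R -> on_sides p q r Y w ->
    holo Cinv (fun u => - (/ (u * u))) (s * w)).
  { intros s w Hs Hsw; apply holo_inv, Cmult_neq_0.
    - intros H; apply RtoC_inj in H; lra.
    - intros H; specialize (Hw w Hsw); rewrite H, Cmod_0 in Hw; lra. }
  apply Cminus_eq_0, Cmod_eq_0, Rle_antisym; [|apply Cmod_ge_0].
  apply le_epsilon; intros e He.
  assert (L : forall P Q a b, (a <= b)%R -> (forall y : R, on_sides p q r Y (P + Q * y)) ->
    at_right 0 (fun s : R =>
      (Cmod (line f (s * P) (s * Q) a b - rho * line Cinv (s * P) (s * Q) a b) <= e / 4)%R)).
  { intros P Q a b Hab HPQ; apply (line_scale_residue f f' rho P Q a b m); auto; lra. }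
  assert (H1 := L p q (- Y)%R Y ltac:(lra) ltac:(intros y; exists y; auto)).
  assert (H2 := L (p + q * Y) r 0%R 1%R ltac:(lra) ltac:(intros y; exists y; auto)).
  assert (H3 := L (p + r) q (- Y)%R Y ltac:(lra) ltac:(intros y; exists y; auto)).
  assert (H4 := L (p - q * Y) r 0%R 1%R ltac:(lra) ltac:(intros y; exists y; auto)).
  assert (H5 : at_right 0 (fun s : R => (0 < s < 1)%R)).
  { exists (mkposreal 1 Rlt_0_1); intros s Hs Hs0.
    change (Rabs (s - 0) < 1)%R in Hs; apply Rabs_def2 in Hs; lra. }
  destruct (filter_ex _ (filter_and _ _ (filter_and _ _ H1 H2)
    (filter_and _ _ (filter_and _ _ H3 H4) H5)))
    as [s [[A1 A2] [[A3 A4] A5]]].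
  rewrite <- (quad_scale f f' p q r Y 0 Hf s A5), <- (quad_scale _ _ p q r Y 0 Hi s A5).
  unfold quad.
  match goal with |- (Cmod ?x <= _)%R => replace x with
   ((line f (s * p) (s * q) (- Y) Y - rho * line Cinv (s * p) (s * q) (- Y) Y)
    + (line f (s * (p + q * Y)) (s * r) 0 1 - rho * line Cinv (s * (p + q * Y)) (s * r) 0 1)
    + - (line f (s * (p + r)) (s * q) (- Y) Y - rho * line Cinv (s * (p + r)) (s * q) (- Y) Y)
    + - (line f (s * (p - q * Y)) (s * r) 0 1 - rho * line Cinv (s * (p - q * Y)) (s * r) 0 1))
   by ring end.
  eapply Rle_trans; [apply Cmod_triangle|].
  rewrite Cmod_opp.
  eapply Rle_trans; [apply Rplus_le_compat_r, Cmod_triangle|].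
  rewrite Cmod_opp.
  eapply Rle_trans; [apply Rplus_le_compat_r, Rplus_le_compat_r, Cmod_triangle|].
  lra.
Qed.

(** Without a pole the contour may be shrunk to s = 0, where every side carries the factor 0; [l] =
    -1 leaves room below 0. *)
Lemma quad_entire (f f' : C -> C) (p q r : C) (Y : R) :
  (forall u, holo f f' u) -> quad f p q r Y 1 = 0.
Proof.
  intros H; rewrite <- (quad_scale f f' p q r Y (-1) ltac:(auto) 0) by lra.
  assert (L : forall P Q a b, line f (0 * P) (0 * Q) a b = 0).
  { intros P Q a b; unfold line; apply is_CRInt_unique.
    apply (is_RInt_ext (V := C_R_NormedModule) (fun _ => (0 : C))); [intros; Cring|].
    replace (RtoC 0) with (scal (b - a)%R (RtoC 0 : C_R_NormedModule)) at 1
      by apply (scal_zero_r (V := C_R_NormedModule)).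
    apply (is_RInt_const (V := C_R_NormedModule)). }
  unfold quad; rewrite !L; ring.
Qed.

(** * Holomorphic functions and limits at infinity *)

(** Hiding the derivative lets the closure rules below be chained without ever computing it; a
    single [f'] serves all of [P]. *)
Definition holo_on (P : C -> Prop) (f : C -> C) : Prop :=
  exists f', forall u, P u -> holo f f' u.

Lemma holo_on_const (P : C -> Prop) (c : C) : holo_on P (fun _ => c).
Proof.
  exists (fun _ => 0); intros u _; split; [|split].
  - apply continuous_const.
  - apply continuous_const.
  - intros g t l _ _; rewrite Cmult_0_l; apply is_derive_Cconst.
Qed.

Lemma holo_on_id (P : C -> Prop) : holo_on P (fun u => u).
Proof.
  exists (fun _ => 1); intros u _; split; [|split].
  - apply continuous_id.
  - apply continuous_const.
  - intros g t l _ Hl; rewrite Cmult_1_l; exact Hl.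
Qed.

Lemma holo_on_plus (P : C -> Prop) (f g : C -> C) :
  holo_on P f -> holo_on P g -> holo_on P (fun u => f u + g u).
Proof.
  intros [f' Hf] [g' Hg]; exists (fun u => f' u + g' u); intros u Hu.
  destruct (Hf u Hu) as [F0 [F1 F2]], (Hg u Hu) as [G0 [G1 G2]]; split; [|split].
  - now apply continuous_Cplus.
  - now apply continuous_Cplus.
  - intros k t l Hk Hl; rewrite Cmult_plus_distr_r.
    apply (is_derive_Cplus (fun s => f (k s)) (fun s => g (k s))); auto.
Qed.

Lemma holo_on_mult (P : C -> Prop) (f g : C -> C) :
  holo_on P f -> holo_on P g -> holo_on P (fun u => f u * g u).
Proof.
  intros [f' Hf] [g' Hg]; exists (fun u => f' u * g u + f u * g' u); intros u Hu.
  destruct (Hf u Hu) as [F0 [F1 F2]], (Hg u Hu) as [G0 [G1 G2]]; split; [|split].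
  - now apply continuous_Cmult.
  - apply continuous_Cplus; now apply continuous_Cmult.
  - intros k t l Hk Hl.
    evar_last.
    + apply (is_derive_Cmult (fun s => f (k s)) (fun s => g (k s))); eauto.
    + rewrite Hk; Cring.
Qed.

Lemma holo_on_Cexp (P : C -> Prop) (f : C -> C) :
  holo_on P f -> holo_on P (fun u => Cexp (f u)).
Proof.
  intros [f' Hf]; exists (fun u => Cexp (f u) * f' u); intros u Hu.
  destruct (Hf u Hu) as [F0 [F1 F2]]; split; [|split].
  - now apply continuous_Cexp.
  - apply continuous_Cmult; [now apply continuous_Cexp|exact F1].
  - intros k t l Hk Hl; rewrite <- Cmult_assoc, <- Hk at 1.
    apply (is_derive_Cexp (fun s => f (k s))); auto.
Qed.

Lemma holo_on_Cinv (P : C -> Prop) (f : C -> C) :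
  (forall u, P u -> f u <> 0) -> holo_on P f -> holo_on P (fun u => / f u).
Proof.
  intros H0 [f' Hf]; exists (fun u => - (1) * (f' u * / (f u * f u))); intros u Hu.
  destruct (Hf u Hu) as [F0 [F1 F2]]; specialize (H0 u Hu); split; [|split].
  - now apply continuous_Cinv.
  - apply continuous_Cmult; [apply continuous_const|].
    apply continuous_Cmult; [exact F1|].
    apply (continuous_Cinv (fun u : C_UniformSpace => f u * f u)).
    + now apply Cmult_neq_0.
    + now apply continuous_Cmult.
  - intros k t l Hk Hl; evar_last.
    + apply (is_derive_Cinv (fun s => f (k s))); [now rewrite Hk|eauto].
    + rewrite Hk; now Cfield.
Qed.

(** The uniform structure of C has product balls, so e / 2 in each component is used to control
    [Cmod] by e; the next lemma converts in the other direction. *)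
Lemma continuous_Cmod_lt (f : C -> C) (u : C) :
  continuous f u -> forall e : R, (0 < e)%R -> exists dl : R, (0 < dl)%R /\
    forall v, (Cmod (v - u) < dl)%R -> (Cmod (f v - f u) <= e)%R.
Proof.
  intros H e He.
  assert (He2 : (0 < e / 2)%R) by lra.
  destruct (H _ (locally_ball (f u : C_UniformSpace) (mkposreal _ He2))) as [dl Hd].
  exists dl; split; [apply cond_pos|]; intros v Hv.
  assert (Hb : ball (u : C_UniformSpace) dl v)
    by (apply C_NormedModule_mixin_compat1; exact Hv).
  destruct (Hd v Hb) as [A B].
  change (Rabs (Re (f v) - Re (f u)) < e / 2)%R in A.
  change (Rabs (Im (f v) - Im (f u)) < e / 2)%R in B.
  replace (f v - f u)
    with ((RtoC (Re (f v) - Re (f u))) + Ci * RtoC (Im (f v) - Im (f u)))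
    by (apply injective_projections; simpl; unfold Re, Im; ring).
  eapply Rle_trans; [apply Cmod_triangle|].
  rewrite Cmod_mult, Cmod_Ci, !Cmod_R; lra.
Qed.

Lemma continuous_of_Cmod_lt (f : C -> C) (u : C) :
  (forall e : R, (0 < e)%R -> exists dl : R, (0 < dl)%R /\
    forall v, (Cmod (v - u) < dl)%R -> (Cmod (f v - f u) <= e)%R) ->
  continuous f u.
Proof.
  intros H P [e He].
  assert (He2 : (0 < e / 2)%R) by (destruct e; simpl; lra).
  destruct (H _ He2) as [dl [Hd Hf]].
  assert (Hd2 : (0 < dl / 2)%R) by lra.
  exists (mkposreal _ Hd2); intros v [A B].
  change (Rabs (Re v - Re u) < dl / 2)%R in A.
  change (Rabs (Im v - Im u) < dl / 2)%R in B.
  apply He, C_NormedModule_mixin_compat1.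
  apply Rle_lt_trans with (e / 2)%R; [|destruct e; simpl; lra].
  apply Hf.
  replace (v - u) with ((RtoC (Re v - Re u)) + Ci * RtoC (Im v - Im u))
    by (apply injective_projections; simpl; unfold Re, Im; ring).
  eapply Rle_lt_trans; [apply Cmod_triangle|].
  rewrite Cmod_mult, Cmod_Ci, !Cmod_R; lra.
Qed.

Definition lim_infty (f : R -> C) (l : C) : Prop :=
  filterlim f (Rbar_locally p_infty) (locally (l : C_R_NormedModule)).

Lemma lim_infty_ext (M : R) (f g : R -> C) (l : C) :
  (forall Y, (M < Y)%R -> f Y = g Y) -> lim_infty f l -> lim_infty g l.
Proof. intros H; apply filterlim_ext_loc; now exists M. Qed.

Lemma lim_infty_unique (f : R -> C) (l l' : C) :
  lim_infty f l -> lim_infty f l' -> l = l'.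
Proof.
  exact (filterlim_locally_unique (V := C_R_NormedModule) (F := Rbar_locally p_infty) f l l').
Qed.

Lemma lim_infty_plus (f g : R -> C) (l l' : C) :
  lim_infty f l -> lim_infty g l' -> lim_infty (fun Y => f Y + g Y) (l + l').
Proof.
  intros Hf Hg.
  exact (filterlim_comp_2 f g plus Hf Hg (filterlim_plus (V := C_R_NormedModule) l l')).
Qed.

Lemma lim_infty_mult_l (c : C) (f : R -> C) (l : C) :
  lim_infty f l -> lim_infty (fun Y => c * f Y) (c * l).
Proof.
  intros Hf; apply (filterlim_comp _ _ _ f (fun u => c * u) _ _ _ Hf).
  apply (continuous_Cmult (U := C_UniformSpace) (fun _ => c) (fun u => u));
    [apply continuous_const|apply continuous_id].
Qed.

Lemma lim_infty_bound (M : R) (f : R -> C) (l : C) (g : R -> R) :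
  is_lim g p_infty 0 -> (forall Y, (M < Y)%R -> (Cmod (f Y - l) <= g Y)%R) ->
  lim_infty f l.
Proof.
  intros Hg H P [e He].
  destruct (Hg _ (locally_ball (0%R : R_UniformSpace) e)) as [N HN].
  exists (Rmax M N); intros Y HY; apply He, C_NormedModule_mixin_compat1.
  pose proof (Rmax_l M N); pose proof (Rmax_r M N).
  apply Rle_lt_trans with (1 := H Y ltac:(lra)).
  specialize (HN Y ltac:(lra)).
  change (Rabs (g Y - 0) < e)%R in HN; apply Rabs_def2 in HN; lra.
Qed.

Lemma is_lim_exp_opp (K : R) : is_lim (fun Y => K * exp (- Y))%R p_infty 0.
Proof.
  replace (Finite 0) with (Rbar_mult K 0) by (simpl; now rewrite Rmult_0_r).
  apply is_lim_scal_l.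
  apply (is_lim_comp exp Ropp p_infty 0 m_infty).
  - apply is_lim_exp_m.
  - apply (is_lim_opp (fun y => y) p_infty p_infty), is_lim_id.
  - now exists 0%R.
Qed.

Lemma is_lim_div_id (K : R) : is_lim (fun Y => K / Y)%R p_infty 0.
Proof.
  replace (Finite 0) with (Rbar_mult K (Rbar_inv p_infty)) by (simpl; now rewrite Rmult_0_r).
  apply is_lim_scal_l, is_lim_inv; [apply is_lim_id|discriminate].
Qed.

(** Cauchy's criterion: the integral from u to v is at most K (exp (- u) - exp (- v)). *)
Lemma lim_infty_CRInt_cauchy (f : R -> C) (M K : R) :
  (forall y, continuous f y) -> (0 <= K)%R ->
  (forall y, (M < y)%R -> (Cmod (f y) <= K * exp (- y))%R) ->
  exists l : C, lim_infty (CRInt f 0) l.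
Proof.
  intros Hc HK Hf.
  apply (filterlim_locally_cauchy (U := C_R_CompleteNormedModule)
    (F := Rbar_locally p_infty)).
  intros e.
  destruct (is_lim_exp_opp K _ (locally_ball (0%R : R_UniformSpace) e)) as [N HN].
  assert (HI : forall u v, (Rmax M N < u)%R -> (u <= v)%R ->
    (Cmod (CRInt f 0 v - CRInt f 0 u) < e)%R).
  { intros u v Hu Huv.
    pose proof (Rmax_l M N); pose proof (Rmax_r M N).
    replace (CRInt f 0 v - CRInt f 0 u) with (CRInt f u v).
    2:{ rewrite <- (RInt_Chasles (V := C_R_CompleteNormedModule) f 0 u v)
          by now apply ex_CRInt.
        match goal with |- _ = ?b => change b with
          (CRInt f 0 u + CRInt f u v - CRInt f 0 u) end.
        generalize (CRInt f 0 u : C) (CRInt f u v : C); intros a b; Cring. }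
    apply Rle_lt_trans with (K * exp (- u) - K * exp (- v))%R.
    - rewrite Cmod_norm.
      apply (norm_RInt_le f (fun y => K * exp (- y))%R u v); [exact Huv| | |].
      + intros y Hy; rewrite <- Cmod_norm; apply Hf; lra.
      + now apply CRInt_correct.
      + replace (K * exp (- u) - K * exp (- v))%R with
          (minus (- (K * exp (- v))) (- (K * exp (- u))))%R
          by (unfold minus, plus, opp; simpl; ring).
        apply (is_RInt_derive (V := R_CompleteNormedModule)
          (fun y => - (K * exp (- y)))%R (fun y => K * exp (- y))%R).
        * intros y _; auto_derive; [auto|ring].
        * intros y _; apply (ex_derive_continuous (fun y => K * exp (- y))%R).
          auto_derive; auto.
    - specialize (HN u ltac:(lra)).
      change (Rabs (K * exp (- u) - 0) < e)%R in HN; apply Rabs_def2 in HN.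
      pose proof (exp_pos (- v)); nra. }
  exists (fun u => (Rmax M N < u)%R); split; [now exists (Rmax M N)|].
  intros u v Hu Hv; apply C_NormedModule_mixin_compat1.
  destruct (Rle_dec u v) as [L|L]; [now apply HI|].
  change (Cmod (CRInt f 0 v - CRInt f 0 u) < e)%R.
  rewrite <- Cmod_opp, Copp_minus_distr; apply HI; lra.
Qed.

(** Completing the square in - a Y^2 + (K + 1) Y. Every Gaussian estimate is thereby weakened to a
    multiple of exp (- Y), whose primitive and limit are explicit. *)
Lemma gauss_le (a K Y : R) :
  (0 < a)%R -> (- a * Y ^ 2 + K * Y <= (K + 1) ^ 2 / (4 * a) - Y)%R.
Proof.
  intros Ha.
  assert (H : (0 <= (2 * a * Y - (K + 1)) ^ 2 / (4 * a))%R).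
  { apply Rmult_le_pos; [apply pow2_ge_0|left; apply Rinv_0_lt_compat; lra]. }
  replace ((2 * a * Y - (K + 1)) ^ 2 / (4 * a))%R
    with (a * Y ^ 2 - (K + 1) * Y + (K + 1) ^ 2 / (4 * a))%R in H by (field; lra).
  lra.
Qed.

Lemma CRInt_symmetric (f g : R -> C) (Y : R) :
  (forall y, continuous f y) -> (forall y, f y + f (- y)%R = g y) ->
  CRInt f (- Y) Y = CRInt g 0 Y.
Proof.
  intros Hc Hg; symmetry; apply is_CRInt_unique.
  apply (is_RInt_ext (V := C_R_NormedModule)
    (fun y => plus (f y) (opp (opp (f (- y)%R))) : C_R_NormedModule)).
  { intros y _; rewrite opp_opp; apply Hg. }
  rewrite <- (RInt_Chasles (V := C_R_CompleteNormedModule) f (- Y) 0 Y)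
    by now apply ex_CRInt.
  rewrite plus_comm.
  apply (is_RInt_plus (V := C_R_NormedModule)); [now apply CRInt_correct|].
  rewrite <- (opp_opp (G := C_R_NormedModule) (CRInt f (- Y) 0)).
  apply (is_RInt_opp (V := C_R_NormedModule)), (is_RInt_comp_opp (V := C_R_NormedModule)).
  apply (is_RInt_swap (V := C_R_NormedModule)); rewrite Ropp_0; now apply CRInt_correct.
Qed.

(** * The integral of 1/u along the parallelogram *)

Lemma rsqrt2_bounds : (1 / 2 <= rsqrt2 <= 1)%R.
Proof. pose proof rsqrt2_pos; pose proof rsqrt2_sqr; split; nra. Qed.

Lemma atan_le_id (t : R) : (0 <= t)%R -> (0 <= atan t <= t)%R.
Proof.
  intros Ht.
  destruct (MVT_gen atan 0 t (fun x => / (1 + x²))%R) as [c [_ Hc]].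
  - intros x _; apply is_derive_atan.
  - intros x _; apply derivable_continuous_pt, derivable_pt_atan.
  - rewrite atan_0, !Rminus_0_r in Hc; rewrite Hc.
    assert (Hp : (1 <= 1 + c²)%R) by (pose proof (Rle_0_sqr c); lra).
    assert (Hi : (0 < / (1 + c²) <= 1)%R).
    { split; [apply Rinv_0_lt_compat; lra|].
      rewrite <- Rinv_1 at 2; apply Rinv_le_contravar; lra. }
    split; nra.
Qed.

(** Since [atan x] is PI / 2 minus [atan (/ x)], the error is at most / x; this makes the limit of
    the contour integral quantitative. *)
Lemma atan_lower (x : R) : (0 < x)%R -> (PI / 2 - / x <= atan x <= PI / 2)%R.
Proof.
  intros Hx; assert (Hi : (0 < / x)%R) by now apply Rinv_0_lt_compat.
  pose proof (atan_inv x Hx); pose proof (atan_le_id (/ x) ltac:(lra)); lra.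
Qed.

(* Dividing by omega, the integrand is 1 / ((y - e) - i e), whose primitive
   needs no branch of the logarithm. *)
Lemma is_CRInt_inv_line (k Y : R) : k <> 0%R ->
  let e := (k * rsqrt2 / 2)%R in
  is_CRInt (fun y : R => / (- (k * Ci / 2) + omega * y) * omega) (- Y) Y
    ((ln ((Y - e) ^ 2 + e ^ 2) - ln ((- Y - e) ^ 2 + e ^ 2)) / 2,
     atan ((Y - e) / e) - atan ((- Y - e) / e))%R.
Proof.
  intros Hk e; pose proof rsqrt2_pos as Hd; pose proof rsqrt2_sqr as Hd2.
  assert (He : e <> 0%R) by (unfold e, Rdiv; repeat apply Rmult_integral_contrapositive_currified; lra).
  assert (HD : forall y, (0 < (y - e) ^ 2 + e ^ 2)%R).
  { intros y; pose proof (pow2_ge_0 (y - e)).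
    assert (0 < e ^ 2)%R by (apply pow2_gt_0, He); lra. }
  set (D := fun y : R => ((y - e) / ((y - e) ^ 2 + e ^ 2), e / ((y - e) ^ 2 + e ^ 2))%R).
  assert (ED : forall y : R, / (- (k * Ci / 2) + omega * y) * omega = D y).
  { intros y.
    assert (E1 : - (k * Ci / 2) + omega * y = (rsqrt2 * y, rsqrt2 * (y - 2 * e))%R).
    { rewrite omega_eq.
      replace (k * Ci / 2) with (RtoC (k / 2) * Ci) by (rewrite RtoC_div by lra; field).
      unfold e; apply injective_projections; simpl; [ring|].
      replace (rsqrt2 * (y - 2 * (k * rsqrt2 / 2)))%R with (rsqrt2 * y - rsqrt2 * rsqrt2 * k)%R by field.
      rewrite Hd2; field. }
    assert (N1 : (rsqrt2 * y, rsqrt2 * (y - 2 * e))%R <> RtoC 0).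
    { intros H; injection H as H1 H2; assert (y = 0)%R by nra; subst y; nra. }
    replace (D y) with (/ (rsqrt2 * y, rsqrt2 * (y - 2 * e))%R * ((rsqrt2 * y, rsqrt2 * (y - 2 * e))%R * D y))
      by (rewrite Cmult_assoc, Cinv_l by exact N1; ring).
    rewrite E1; f_equal; rewrite omega_eq; unfold D.
    specialize (HD y).
    apply injective_projections; simpl; field; lra. }
  apply (is_RInt_ext (V := C_R_NormedModule) D); [intros y _; symmetry; apply ED|].
  set (P := fun y : R => (ln ((y - e) ^ 2 + e ^ 2) / 2, atan ((y - e) / e))%R).
  replace (_, _) with (minus (G := C_R_NormedModule) (P Y) (P (- Y)%R))
    by (apply injective_projections; simpl; unfold plus, opp; simpl; field).
  apply (is_RInt_derive (V := C_R_CompleteNormedModule) P D).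
  - intros y _; specialize (HD y); apply is_derive_C; simpl.
    + auto_derive; [simpl in HD; lra|]. field; simpl in HD; lra.
    + evar_last; [apply (is_derive_comp atan (fun y => (y - e) / e)%R)|].
      * apply is_derive_atan.
      * auto_derive; [exact I|reflexivity].
      * unfold scal; simpl; unfold mult; simpl; unfold Rsqr.
        field; repeat split; simpl in HD; try lra; nra.
  - intros y _; specialize (HD y); apply continuous_C; simpl.
    + apply (ex_derive_continuous (fun y => (y - e) / ((y - e) ^ 2 + e ^ 2))%R).
      auto_derive; simpl in HD; lra.
    + apply (ex_derive_continuous (fun y => e / ((y - e) ^ 2 + e ^ 2))%R).
      auto_derive; simpl in HD; lra.
Qed.

(** Along a vertical side the real part is constant, so |w| >= |Re p| >= Y / 2, and the side has
    length 1. *)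
Lemma Cmod_line_inv_le (p : C) (Y : R) :
  (1 <= Y)%R -> (rsqrt2 * Y <= Rabs (Re p))%R -> (Cmod (line Cinv p Ci 0 1) <= 2 / Y)%R.
Proof.
  intros HY Hp; pose proof rsqrt2_bounds.
  assert (Hw : forall y : R, (Y / 2 <= Cmod (p + Ci * y))%R).
  { intros y; apply Rle_trans with (2 := re_le_Cmod _).
    replace (Re (p + Ci * y)) with (Re p) by (simpl; unfold Re; ring); nra. }
  assert (Hn : forall y : R, p + Ci * y <> 0).
  { intros y H0; specialize (Hw y); rewrite H0, Cmod_0 in Hw; lra. }
  replace (2 / Y)%R with ((1 - 0) * (2 / Y))%R by ring.
  apply Cmod_CRInt_le; [lra| |].
  - intros y; apply continuous_line, (holo_inv _ (Hn y)).
  - intros y _; rewrite Cmod_mult, Cmod_Ci, Rmult_1_r, Cmod_inv by apply Hn.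
    replace (2 / Y)%R with (/ (Y / 2))%R by (field; lra).
    apply Rinv_le_contravar; [lra|apply Hw].
Qed.

(** The contour is symmetric under u -> - u, so its two long sides contribute equally. On one of
    them the logarithms cancel in the limit and the two arctangents tend to PI / 2 each, which makes
    PI Ci per long side. *)
Lemma quad_inv_lim :
  lim_infty (fun Y => quad Cinv (- (Ci / 2)) omega Ci Y 1) (2 * PI * Ci).
Proof.
  pose proof rsqrt2_bounds as Hd; pose proof rsqrt2_sqr as Hd2.
  (* The errors add up to at most 20 / Y: 8 / Y from the logarithms, 8 / Y from the arctangents and
     2 / Y from each short side. *)
  apply (lim_infty_bound 2 _ _ (fun Y => 24 / Y)%R); [apply is_lim_div_id|].
  intros Y HY; unfold quad; rewrite !Cmult_1_l.
  assert (S1 := Cmod_line_inv_le (- (Ci / 2) + omega * Y) Y ltac:(lra)).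
  assert (S2 := Cmod_line_inv_le (- (Ci / 2) - omega * Y) Y ltac:(lra)).
  assert (E0 : Ci / 2 = (0, 1 / 2)%R) by (apply injective_projections; simpl; field).
  assert (R1 : Re (- (Ci / 2) + omega * Y) = (rsqrt2 * Y)%R)
    by (rewrite omega_eq, E0; simpl; ring).
  assert (R2 : Re (- (Ci / 2) - omega * Y) = (- (rsqrt2 * Y))%R)
    by (rewrite omega_eq, E0; simpl; ring).
  rewrite R1, Rabs_pos_eq in S1 by nra; specialize (S1 (Rle_refl _)).
  rewrite R2, Rabs_Ropp, Rabs_pos_eq in S2 by nra; specialize (S2 (Rle_refl _)).
  pose proof (is_CRInt_inv_line 1 Y ltac:(lra)) as B1.
  pose proof (is_CRInt_inv_line (-1) Y ltac:(lra)) as B2.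
  cbv zeta in B1, B2.
  apply is_CRInt_unique in B1; apply is_CRInt_unique in B2.
  set (e := (rsqrt2 / 2)%R) in *.
  assert (L1 : line Cinv (- (Ci / 2)) omega (- Y) Y =
    ((ln ((Y - e) ^ 2 + e ^ 2) - ln ((Y + e) ^ 2 + e ^ 2)) / 2,
     atan ((Y - e) / e) + atan ((Y + e) / e))%R).
  { replace (- (Ci / 2)) with (- (1%R * Ci / 2)) by (field).
    unfold line; rewrite B1.
    replace (1 * rsqrt2 / 2)%R with e by (unfold e; field).
    f_equal; [do 4 f_equal; ring|].
    replace ((- Y - e) / e)%R with (- ((Y + e) / e))%R by (field; unfold e; lra).
    rewrite atan_opp; ring. }
  assert (L2 : line Cinv (- (Ci / 2) + Ci) omega (- Y) Y =
    - line Cinv (- (Ci / 2)) omega (- Y) Y).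
  { rewrite L1; replace (- (Ci / 2) + Ci) with (- ((-1)%R * Ci / 2)).
    2:{ field. }
    unfold line; rewrite B2.
    replace (-1 * rsqrt2 / 2)%R with (- e)%R by (unfold e; field).
    replace ((Y - - e) / - e)%R with (- ((Y + e) / e))%R by (field; unfold e; lra).
    replace ((- Y - - e) / - e)%R with ((Y - e) / e)%R by (field; unfold e; lra).
    rewrite atan_opp.
    replace ((Y - - e) ^ 2 + (- e) ^ 2)%R with ((Y + e) ^ 2 + e ^ 2)%R by ring.
    replace ((- Y - - e) ^ 2 + (- e) ^ 2)%R with ((Y - e) ^ 2 + e ^ 2)%R by ring.
    apply injective_projections; simpl; field. }
  rewrite L2, L1.
  set (A := ((Y - e) ^ 2 + e ^ 2)%R); set (B := ((Y + e) ^ 2 + e ^ 2)%R).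
  assert (He : (1 / 4 <= e <= 1 / 2)%R) by (unfold e; lra).
  assert (HA : (Y * Y / 4 <= A)%R) by (unfold A; nra).
  assert (HB : (B - A = 4 * Y * e)%R) by (unfold A, B; ring).
  assert (HA0 : (0 < A)%R) by nra.
  assert (HY0 : (0 < / Y)%R) by (apply Rinv_0_lt_compat; lra).
  (* From ln x <= x - 1 at x = B / A: here B - A = 4 Y e with e <= 1/2, and A >= Y^2 / 4. *)
  assert (HlnA : (0 <= ln B - ln A <= 8 / Y)%R).
  { split.
    - assert (ln A <= ln B)%R by (apply ln_le; nra); lra.
    - rewrite <- ln_div by nra.
      apply Rle_trans with (B / A - 1)%R.
      + pose proof (exp_ineq1_le (ln (B / A))) as Hx.
        rewrite exp_ln in Hx by (apply Rdiv_lt_0_compat; nra); lra.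
      + replace (B / A - 1)%R with ((B - A) / A)%R by (field; lra).
        apply Rle_div_l; [lra|].
        replace (8 / Y * A)%R with (8 * (A * / Y))%R by (field; lra).
        assert (Y / 4 <= A * / Y)%R.
        { replace (Y / 4)%R with (Y * Y / 4 * / Y)%R by (field; lra).
          apply Rmult_le_compat_r; lra. }
        nra. }
  assert (T1 : (PI / 2 - 2 / Y <= atan ((Y - e) / e) <= PI / 2)%R).
  { pose proof (atan_lower ((Y - e) / e)) as H.
    specialize (H ltac:(apply Rdiv_lt_0_compat; lra)); split; [|lra].
    apply Rle_trans with (2 := proj1 H).
    replace (/ ((Y - e) / e))%R with (e / (Y - e))%R by (field; lra).
    apply Rplus_le_compat_l, Ropp_le_contravar.
    apply Rle_div_l; [lra|]; replace (2 / Y * (Y - e))%R with (2 - 2 * e * / Y)%R by (field; lra).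
    assert (/ Y <= 1 / 2)%R by (replace (1 / 2)%R with (/ 2)%R by field; apply Rinv_le_contravar; lra); nra. }
  assert (T2 : (PI / 2 - 2 / Y <= atan ((Y + e) / e) <= PI / 2)%R).
  { pose proof (atan_lower ((Y + e) / e)) as H.
    specialize (H ltac:(apply Rdiv_lt_0_compat; lra)); split; [|lra].
    apply Rle_trans with (2 := proj1 H).
    replace (/ ((Y + e) / e))%R with (e / (Y + e))%R by (field; lra).
    apply Rplus_le_compat_l, Ropp_le_contravar.
    apply Rle_div_l; [lra|]; replace (2 / Y * (Y + e))%R with (2 + 2 * e * / Y)%R by (field; lra).
    nra. }
  revert S1 S2; generalize (line Cinv (- (Ci / 2) + omega * Y) Ci 0 1).
  generalize (line Cinv (- (Ci / 2) - omega * Y) Ci 0 1); intros l2 l1 S1 S2.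
  revert T1 T2; generalize (atan ((Y - e) / e)) (atan ((Y + e) / e)); intros t1 t2 T1 T2.
  match goal with |- (Cmod ?x <= _)%R => replace x with
    (RtoC (ln A - ln B) + Ci * RtoC (2 * t1 + 2 * t2 - 2 * PI) + l1 + - l2)
    by (apply injective_projections; simpl; field) end.
  eapply Rle_trans; [apply Cmod_triangle|]; rewrite Cmod_opp.
  eapply Rle_trans; [apply Rplus_le_compat_r, Cmod_triangle|].
  eapply Rle_trans; [apply Rplus_le_compat_r, Rplus_le_compat_r, Cmod_triangle|].
  rewrite Cmod_mult, Cmod_Ci, !Cmod_R.
  assert (Rabs (ln A - ln B) <= 8 / Y)%R by (apply Rabs_le; lra).
  assert (Rabs (2 * t1 + 2 * t2 - 2 * PI) <= 8 / Y)%R by (apply Rabs_le; lra).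
  lra.
Qed.

(** * The Mordell integral as a contour integral *)

Lemma holo_on_opp (P : C -> Prop) (f : C -> C) :
  holo_on P f -> holo_on P (fun u => - f u).
Proof.
  intros [f' Hf]; exists (fun u => - f' u); intros u Hu.
  destruct (Hf u Hu) as [F0 [F1 F2]]; split; [|split].
  - now apply (continuous_opp (V := C_R_NormedModule)).
  - now apply (continuous_opp (V := C_R_NormedModule)).
  - intros k t l Hk Hl; replace (- f' u * l) with (- (f' u * l)) by ring.
    apply (is_derive_opp (V := C_R_NormedModule)); auto.
Qed.

Lemma exp_le_mono (x y : R) : (x <= y)%R -> (exp x <= exp y)%R.
Proof.
  intros [H|H]; [left; now apply exp_increasing|right; now rewrite H].
Qed.

Lemma Ccosh_0 : Ccosh 0 = 1.
Proof. unfold Ccosh; rewrite Copp_0, Cexp_0; field. Qed.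

Lemma Ccosh_opp (w : C) : Ccosh (- w) = Ccosh w.
Proof. unfold Ccosh; replace (- - w) with w by ring; f_equal; ring. Qed.

Lemma Ccosh_imaginary (b : R) : Ccosh (0, b)%R = RtoC (cos b).
Proof.
  unfold Ccosh, Cexp; simpl; rewrite Ropp_0, exp_0, cos_neg, sin_neg.
  apply injective_projections; simpl; field.
Qed.

(** By evenness one may take Re w >= 0; the reverse triangle inequality then gives (exp (Re w) - exp
    (- Re w)) / 2. The crude linear bound suffices both for non-vanishing off the imaginary axis and
    for estimating the denominator far out. *)
Lemma Cmod_Ccosh_ge (w : C) : (Rabs (Re w) / 2 <= Cmod (Ccosh w))%R.
Proof.
  assert (K : forall v, (0 <= Re v)%R -> (Re v / 2 <= Cmod (Ccosh v))%R).
  { intros v Hv; unfold Ccosh.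
    rewrite Cmod_div by (intros H; apply RtoC_inj in H; lra).
    rewrite (Cmod_R 2), (Rabs_pos_eq 2) by lra.
    apply Rmult_le_compat_r; [lra|].
    apply Rle_trans with (Cmod (Cexp v) - Cmod (Cexp (- v)))%R.
    - rewrite !Cmod_Cexp; simpl.
      pose proof (exp_ineq1_le (Re v)) as H1.
      assert (exp (- fst v) <= 1)%R; [|unfold Re in *; lra].
      rewrite <- exp_0; apply exp_le_mono; unfold Re in *; lra.
    - pose proof (Cmod_triangle (Cexp v + Cexp (- v)) (- Cexp (- v))) as H.
      replace (Cexp v + Cexp (- v) + - Cexp (- v)) with (Cexp v) in H by ring.
      rewrite Cmod_opp in H; lra. }
  unfold Rabs; destruct (Rcase_abs (Re w)) as [H|H].
  - rewrite <- Ccosh_opp; apply (K (- w)); simpl; unfold Re in *; lra.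
  - apply K; lra.
Qed.

Lemma Ccosh_neq_0 (w : C) :
  (Re w = 0 -> cos (Im w) <> 0)%R -> Ccosh w <> 0.
Proof.
  intros H H0; destruct (Req_dec (Re w) 0) as [E|E].
  - apply (H E); rewrite (surjective_pairing w) in H0.
    change (fst w) with (Re w) in H0; rewrite E, Ccosh_imaginary in H0.
    now apply RtoC_inj in H0.
  - pose proof (Cmod_Ccosh_ge w) as H1; rewrite H0, Cmod_0 in H1.
    pose proof (Rabs_pos_lt _ E); lra.
Qed.

(** The line [omega] R meets the imaginary axis, where all zeros of cosh lie, only at 0. *)
Lemma Ccosh_omega_neq_0 (y : R) : Ccosh (PI * (omega * y)) <> 0.
Proof.
  pose proof rsqrt2_pos; pose proof PI_RGT_0.
  apply Ccosh_neq_0; rewrite omega_eq; simpl; intros E.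
  assert (Hy : (PI * rsqrt2 * y = 0)%R) by lra.
  assert (y = 0)%R
    by (apply Rmult_integral in Hy; destruct Hy as [Hy|Hy]; [exfalso; nra|exact Hy]); subst y.
  replace (PI * (rsqrt2 * 0 + rsqrt2 * 0) + 0 * (rsqrt2 * 0 - rsqrt2 * 0))%R with 0%R by ring.
  rewrite cos_0; lra.
Qed.

Definition kernel (z tau : R) (x : C) : C :=
  Cexp (PI * Ci * tau * (x * x) + - (2 * PI * z * x)) * / Ccosh (PI * x).

Lemma holo_on_kernel (P : C -> Prop) (z tau : R) (g : C -> C) :
  (forall u, P u -> Ccosh (PI * g u) <> 0) -> holo_on P g ->
  holo_on P (fun u => kernel z tau (g u)).
Proof.
  intros H0 Hg; unfold kernel; apply holo_on_mult.
  - apply holo_on_Cexp, holo_on_plus.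
    + apply holo_on_mult; [apply holo_on_const|]; now apply holo_on_mult.
    + apply holo_on_opp, holo_on_mult; [apply holo_on_const|exact Hg].
  - apply holo_on_Cinv; [exact H0|].
    assert (Hp : holo_on P (fun u => PI * g u))
      by (apply holo_on_mult; [apply holo_on_const|exact Hg]).
    unfold Ccosh, Cdiv; apply holo_on_mult; [|apply holo_on_const].
    apply holo_on_plus; apply holo_on_Cexp; [exact Hp|now apply holo_on_opp].
Qed.

Lemma continuous_kernel_omega (z tau y : R) : continuous (fun y : R => kernel z tau (omega * y)) y.
Proof.
  apply (continuous_comp (fun y : R => omega * y) (kernel z tau)); [Ccont|].
  destruct (holo_on_kernel (fun u => Ccosh (PI * u) <> 0) z tau (fun u => u)) as [G' HG].
  - auto.
  - apply holo_on_id.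
  - apply (HG (omega * y) (Ccosh_omega_neq_0 y)).
Qed.

(** At x = omega y one has x^2 = Ci y^2, so the quadratic phase becomes the real Gaussian exp (- PI
    tau y^2); adding the values at y and - y turns the linear exponential into a cosh. Hence the
    half-line integral with factor 2. *)
Lemma kernel_even_part (z tau y : R) :
  kernel z tau (omega * y) + kernel z tau (omega * (- y)%R) = 2 * mordell_integrand z tau y.
Proof.
  unfold kernel, mordell_integrand; fold omega.
  rewrite RtoC_opp.
  replace (PI * (omega * - y)) with (- (PI * (omega * y))) by ring.
  replace (PI * omega * y) with (PI * (omega * y)) by ring.
  rewrite Ccosh_opp, !Cexp_plus, <- Cexp_RtoC.
  replace (omega * - y * (omega * - y)) with (omega * omega * (y * y)) by ring.
  replace (omega * y * (omega * y)) with (omega * omega * (y * y)) by ring.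
  rewrite omega_sqr.
  replace (PI * Ci * tau * (Ci * (y * y))) with (RtoC (- PI * tau * y ^ 2)).
  2:{ rewrite !RtoC_mult, RtoC_opp, RtoC_pow.
      transitivity (Ci * Ci * (PI * tau * (y * y))); [|ring].
      replace (Ci * Ci) with (- (1)) by (apply injective_projections; simpl; ring); ring. }
  unfold Ccosh at 3.
  replace (- (2 * PI * z * (omega * - y))) with (2 * PI * z * omega * y) by ring.
  replace (2 * PI * z * (omega * y)) with (2 * PI * z * omega * y) by ring.
  field; apply Ccosh_omega_neq_0.
Qed.

Lemma continuous_mordell_integrand (z tau y : R) :
  continuous (mordell_integrand z tau) y.
Proof.
  apply (continuous_ext (fun y : R => / 2 * (kernel z tau (omega * y) + kernel z tau (omega * (- y)%R)))).
  { intros x; rewrite kernel_even_part.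
    Cfield. }
  apply continuous_Cmult; [apply continuous_const|].
  apply continuous_Cplus; [apply continuous_kernel_omega|].
  apply (continuous_comp Ropp (fun y : R => kernel z tau (omega * y)));
    [|apply continuous_kernel_omega].
  apply (continuous_opp (V := R_NormedModule) (fun y => y)), continuous_id.
Qed.

(** The constant of [gauss_le] for a = PI tau and K = 2 PI tau + 2 PI |z|, times 2 for the bound of
    1 / |cosh|. *)
Definition kernel_bound (z tau : R) : R :=
  (2 * exp ((2 * PI * tau + 2 * PI * Rabs z + 1) ^ 2 / (4 * (PI * tau))))%R.

(** Uniformity in t lets one estimate serve twice: t = 0 gives convergence along [omega] R, and t
    running over [0, 1] covers the vertical sides. *)
Lemma Cmod_kernel_le (z tau y t : R) :
  (0 < tau)%R -> (1 <= Rabs y)%R -> (0 <= t <= 1)%R ->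
  (Cmod (kernel z tau (omega * y + Ci * t)) <= kernel_bound z tau * exp (- Rabs y))%R.
Proof.
  intros Ht Hy Ht1; pose proof rsqrt2_bounds as Hd; pose proof rsqrt2_sqr as Hd2.
  pose proof PI_RGT_0 as Hpi; pose proof PI2_3_2 as Hpi3.
  assert (Ex : omega * y + Ci * t = (rsqrt2 * y, rsqrt2 * y + t)%R)
    by (rewrite omega_eq; apply injective_projections; simpl; ring).
  rewrite Ex; unfold kernel; set (x := (rsqrt2 * y, rsqrt2 * y + t)%R : C).
  (* The real part of PI x is PI rsqrt2 y, of modulus at least 1 because PI > 3 and rsqrt2 >=
     1/2. *)
  assert (HD : (1 / 2 <= Cmod (Ccosh (PI * x)))%R).
  { apply Rle_trans with (2 := Cmod_Ccosh_ge _).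
    replace (Re (PI * x)) with (PI * rsqrt2 * y)%R by (unfold x; simpl; ring).
    rewrite !Rabs_mult, (Rabs_pos_eq PI), (Rabs_pos_eq rsqrt2) by lra.
    assert (1 <= PI * rsqrt2)%R by nra; nra. }
  assert (HD0 : Ccosh (PI * x) <> 0)
    by (intros H; rewrite H, Cmod_0 in HD; lra).
  rewrite Cmod_mult, Cmod_inv, Cmod_Cexp by exact HD0.
  unfold kernel_bound.
  set (K := (2 * PI * tau + 2 * PI * Rabs z)%R).
  apply Rle_trans with
    (exp ((K + 1) ^ 2 / (4 * (PI * tau))) * exp (- Rabs y) * 2)%R; [|right; ring].
  apply Rmult_le_compat.
  - left; apply exp_pos.
  - left; apply Rinv_0_lt_compat; lra.
  - rewrite <- exp_plus; apply exp_le_mono.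
    apply Rle_trans with (- (PI * tau) * Rabs y ^ 2 + K * Rabs y)%R;
      [|apply Rle_trans with (1 := gauss_le (PI * tau) K (Rabs y) ltac:(nra)); lra].
    replace (Re (PI * Ci * tau * (x * x) + - (2 * PI * z * x)))
      with (- (PI * tau) * (2 * (rsqrt2 * rsqrt2) * (y * y)) + PI * tau * (2 * rsqrt2 * t) * (- y)
            + 2 * PI * rsqrt2 * (- (z * y)))%R by (unfold x; simpl; ring).
    rewrite Hd2, pow2_abs; unfold K.
    assert (H1 : (- y <= Rabs y)%R) by (rewrite <- Rabs_Ropp; apply Rle_abs).
    assert (H2 : (- (z * y) <= Rabs z * Rabs y)%R)
      by (rewrite <- Rabs_mult, <- Rabs_Ropp; apply Rle_abs).
    assert (H3 : (0 <= Rabs z * Rabs y)%R)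
      by (apply Rmult_le_pos; apply Rabs_pos).
    assert (H4 : (PI * tau * (2 * rsqrt2 * t) * - y <= 2 * PI * tau * Rabs y)%R).
    { apply Rle_trans with (PI * tau * (2 * rsqrt2 * t) * Rabs y)%R.
      - apply Rmult_le_compat_l; [|exact H1].
        apply Rmult_le_pos; [|nra]; nra.
      - replace (2 * PI * tau * Rabs y)%R with (PI * tau * 2 * Rabs y)%R by ring.
        apply Rmult_le_compat_r; [lra|]; apply Rmult_le_compat_l; nra. }
    assert (H5 : (2 * PI * rsqrt2 * - (z * y) <= 2 * PI * (Rabs z * Rabs y))%R).
    { apply Rle_trans with (2 * PI * rsqrt2 * (Rabs z * Rabs y))%R.
      - apply Rmult_le_compat_l; [nra|exact H2].
      - apply Rmult_le_compat_r; [exact H3|nra]. }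
    nra.
  - replace 2%R with (/ (1 / 2))%R by field.
    apply Rinv_le_contravar; [lra|exact HD].
Qed.

Definition mordell_part (z tau Y : R) : C := 2 * omega * CRInt (mordell_integrand z tau) 0 Y.

Lemma mordell_part_lim (z tau : R) : (0 < tau)%R -> lim_infty (mordell_part z tau) (mordell_pos z tau).
Proof.
  intros Ht.
  destruct (lim_infty_CRInt_cauchy (mordell_integrand z tau) 1 (kernel_bound z tau)) as [l Hl].
  - apply continuous_mordell_integrand.
  - unfold kernel_bound; pose proof (exp_pos ((2 * PI * tau + 2 * PI * Rabs z + 1) ^ 2
      / (4 * (PI * tau)))); lra.
  - intros y Hy.
    replace (mordell_integrand z tau y)
      with (/ 2 * (kernel z tau (omega * y) + kernel z tau (omega * (- y)%R)))
      by (rewrite kernel_even_part; field).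
    rewrite Cmod_mult, Cmod_inv, Cmod_R, (Rabs_pos_eq 2) by
      (try (intros H; apply RtoC_inj in H); lra).
    assert (B1 := Cmod_kernel_le z tau y 0 Ht).
    assert (B2 := Cmod_kernel_le z tau (- y) 0 Ht).
    replace (omega * y + Ci * 0) with (omega * y) in B1 by ring.
    replace (omega * (- y)%R + Ci * 0) with (omega * (- y)%R) in B2 by ring.
    rewrite Rabs_Ropp in B2; rewrite Rabs_pos_eq in B1, B2 by lra.
    specialize (B1 ltac:(lra) ltac:(lra)); specialize (B2 ltac:(lra) ltac:(lra)).
    pose proof (Cmod_triangle (kernel z tau (omega * y)) (kernel z tau (omega * (- y)%R))); lra.
  - replace (mordell_pos z tau) with (2 * omega * l); [now apply lim_infty_mult_l|].
    unfold mordell_pos; fold omega; f_equal; symmetry.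
    apply (is_RInt_gen_unique (V := C_R_CompleteNormedModule)).
    intros P HP; specialize (Hl P HP).
    (* The filter [at_point 0] freezes the lower end, so the improper integral is the limit in the
       upper end alone. *)
    exists (fun a => a = 0%R) (fun Y => P (CRInt (mordell_integrand z tau) 0 Y)).
    + reflexivity.
    + exact Hl.
    + intros a b Ha Hb; subst a; simpl.
      exists (CRInt (mordell_integrand z tau) 0 b); split; [|exact Hb].
      apply CRInt_correct, continuous_mordell_integrand.
Qed.

Lemma line_kernel (z tau Y : R) : CRInt (fun y : R => kernel z tau (omega * y) * omega) (- Y) Y = mordell_part z tau Y.
Proof.
  unfold mordell_part.
  rewrite (CRInt_symmetric _ (fun y => 2 * omega * mordell_integrand z tau y)).
  - apply is_CRInt_unique, is_CRInt_mult_l, CRInt_correct, continuous_mordell_integrand.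
  - intros y; apply continuous_Cmult; [apply continuous_kernel_omega|apply continuous_const].
  - intros y; rewrite <- Cmult_plus_distr_r, kernel_even_part; ring.
Qed.

(** * The pole of the kernel and its quasi-periodicity *)

(** The function sinh u / u, written as an integral so that it is defined at 0 without division and
    takes the value 1 there. *)
Definition sinhc (u : C) : C := CRInt (fun t : R => Ccosh (u * t)) 0 1.

Lemma continuous_Ccosh (u : C) : continuous Ccosh u.
Proof.
  unfold Ccosh, Cdiv; apply continuous_Cmult; [|apply continuous_const].
  apply continuous_Cplus; apply continuous_Cexp; [apply continuous_id|].
  apply (continuous_opp (V := C_R_NormedModule)), continuous_id.
Qed.

Lemma continuous_Ccosh_line (u : C) (t : R) : continuous (fun t : R => Ccosh (u * t)) t.
Proof.
  apply (continuous_comp (fun t : R => u * t) Ccosh); [Ccont|apply continuous_Ccosh].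
Qed.

Lemma sinhc_spec (u : C) : u * sinhc u = (Cexp u - Cexp (- u)) / 2.
Proof.
  unfold sinhc.
  rewrite <- (is_CRInt_unique _ 0 1 _
    (is_CRInt_mult_l u _ _ _ _ (CRInt_correct _ 0 1 (continuous_Ccosh_line u)))).
  apply is_CRInt_unique.
  assert (D : forall (v : C) (t : R),
    is_Cderive (fun t : R => Cexp (v * t)) t (Cexp (v * t) * v)).
  { intros v t; apply (is_derive_Cexp (fun t : R => v * t)); evar_last.
    - apply (is_derive_Cmult (fun _ => v) RtoC);
        [apply is_derive_Cconst|apply is_derive_RtoC].
    - Cring. }
  set (S := fun t : R => / 2 * (Cexp (u * t) + - (1) * Cexp (- u * t))).
  replace ((Cexp u - Cexp (- u)) / 2) with (minus (G := C_R_NormedModule) (S 1%R) (S 0%R)).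
  2:{ unfold S; match goal with |- ?a = ?b => change a with
        (/ 2 * (Cexp (u * 1) + - (1) * Cexp (- u * 1))
         - / 2 * (Cexp (u * 0) + - (1) * Cexp (- u * 0))) end.
      rewrite !Cmult_1_r, !Cmult_0_r; Cfield. }
  apply (is_RInt_derive (V := C_R_CompleteNormedModule) S).
  - intros t _; unfold S; evar_last.
    + apply (is_derive_Cmult (fun _ => / 2)); [apply is_derive_Cconst|].
      apply is_derive_Cplus; [apply D|].
      apply (is_derive_Cmult (fun _ => - (1))); [apply is_derive_Cconst|apply D].
    + unfold Ccosh; replace (- u * t) with (- (u * t)) by ring; Cfield.
  - intros t _; apply continuous_Cmult; [apply continuous_const|apply continuous_Ccosh_line].
Qed.

Lemma is_CRInt_const_unit (c : C) : is_CRInt (fun _ => c) 0 1 c.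
Proof.
  evar_last; [apply (is_RInt_const (V := C_R_NormedModule))|].
  rewrite Rminus_0_r; apply (scal_one (V := C_R_NormedModule)).
Qed.

Lemma sinhc_0 : sinhc 0 = 1.
Proof.
  unfold sinhc; apply is_CRInt_unique.
  apply (is_RInt_ext (V := C_R_NormedModule) (fun _ => (1 : C))).
  { intros t _; rewrite Cmult_0_l, Ccosh_0; reflexivity. }
  apply is_CRInt_const_unit.
Qed.

Lemma continuous_sinhc_0 : continuous sinhc (RtoC 0).
Proof.
  apply continuous_of_Cmod_lt; intros e He.
  destruct (continuous_Cmod_lt Ccosh 0 (continuous_Ccosh 0) e He) as [dl [Hd H]].
  exists dl; split; [exact Hd|]; intros v Hv.
  rewrite sinhc_0.
  assert (HI : is_CRInt (fun t : R => Ccosh (v * t) - 1) 0 1 (sinhc v - 1)).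
  { apply (is_RInt_minus (V := C_R_NormedModule) (fun t : R => Ccosh (v * t)) (fun _ => RtoC 1)).
    - apply CRInt_correct, continuous_Ccosh_line.
    - apply is_CRInt_const_unit. }
  apply is_CRInt_unique in HI; rewrite <- HI.
  replace e with ((1 - 0) * e)%R by ring.
  apply Cmod_CRInt_le; [lra| |].
  - intros t; apply (continuous_minus (V := C_R_NormedModule) (fun t : R => Ccosh (v * t)));
      [apply continuous_Ccosh_line|apply continuous_const].
  - intros t Ht; rewrite <- Ccosh_0; apply H.
    replace (v - 0) with v in Hv by ring; replace (v * t - 0) with (v * t) by ring.
    rewrite Cmod_mult, Cmod_R, Rabs_pos_eq by lra.
    pose proof (Cmod_ge_0 v); nra.
Qed.

(** Since cosh (PI (i/2 + u)) = i sinh (PI u) = PI i u sinhc (PI u), the factor u cancels and leaves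
    a function [W] continuous at 0, whose value there is the residue. *)
Lemma kernel_residue (z tau e : R) : (0 < e)%R -> exists dl : R, (0 < dl)%R /\
  forall u : C, u <> 0 -> (Cmod u < dl)%R ->
  (Cmod (u * kernel z tau (Ci / 2 + u)
    - Cexp (- (PI * Ci * z) - PI * Ci * tau / 4) / (PI * Ci)) <= e)%R.
Proof.
  intros He.
  assert (Hpi : RtoC PI <> 0)
    by (intros H; apply RtoC_inj in H; pose proof PI_RGT_0; lra).
  assert (Hi : Ci <> 0) by (intros H; injection H as H; lra).
  assert (Cid : forall u : C, continuous (fun u : C => PI * u) u)
    by (intros u; apply continuous_Cmult; [apply continuous_const|apply continuous_id]).
  assert (CS : continuous (fun u : C => sinhc (PI * u)) (RtoC 0)).
  { apply (continuous_comp (fun u : C => PI * u) sinhc); [apply Cid|].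
    rewrite Cmult_0_r; apply continuous_sinhc_0. }
  set (W := fun u : C =>
    Cexp (PI * Ci * tau * ((Ci / 2 + u) * (Ci / 2 + u)) + - (1) * (2 * PI * z * (Ci / 2 + u)))
    * / (PI * Ci * sinhc (PI * u))).
  assert (CW : continuous W (RtoC 0)).
  { assert (C0 : continuous (fun u : C => Ci / 2 + u) (RtoC 0))
      by (apply continuous_Cplus; [apply continuous_const|apply continuous_id]).
    unfold W; apply continuous_Cmult.
    - apply continuous_Cexp, continuous_Cplus; apply continuous_Cmult;
        try apply continuous_const; apply continuous_Cmult;
        try apply continuous_const; exact C0.
    - apply (continuous_Cinv (fun u : C_UniformSpace => PI * Ci * sinhc (PI * u))).
      + rewrite Cmult_0_r, sinhc_0, Cmult_1_r; now apply Cmult_neq_0.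
      + apply continuous_Cmult; [apply continuous_const|exact CS]. }
  assert (W0 : W 0 = Cexp (- (PI * Ci * z) - PI * Ci * tau / 4) / (PI * Ci)).
  { unfold W; rewrite Cmult_0_r, sinhc_0, Cmult_1_r, Cplus_0_r; unfold Cdiv at 4.
    f_equal; f_equal.
    replace (Ci / 2 * (Ci / 2)) with (- (1) / 4);
      [field|apply injective_projections; simpl; field]. }
  destruct (continuous_Cmod_lt W 0 CW e He) as [d1 [Hd1 H1]].
  (* Within 1/2 of its value 1 at the origin, sinhc (PI u) cannot vanish, so the cancellation in [W]
     is legitimate. *)
  destruct (continuous_Cmod_lt _ 0 CS (1 / 2)%R ltac:(lra)) as [d2 [Hd2 H2]].
  exists (Rmin d1 d2); split; [now apply Rmin_glb_lt|]; intros u Hu Hud.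
  assert (Eu : u - 0 = u) by ring.
  specialize (H1 u); specialize (H2 u); rewrite Eu in H1, H2.
  specialize (H1 (Rlt_le_trans _ _ _ Hud (Rmin_l _ _))).
  specialize (H2 (Rlt_le_trans _ _ _ Hud (Rmin_r _ _))).
  assert (HS : sinhc (PI * u) <> 0).
  { intros E; rewrite E, Cmult_0_r, sinhc_0 in H2.
    replace (0 - 1) with (- (1)) in H2 by ring; rewrite Cmod_m1 in H2; lra. }
  rewrite <- W0; replace (u * kernel z tau (Ci / 2 + u)) with (W u); [exact H1|].
  unfold W, kernel.
  replace (Ccosh (PI * (Ci / 2 + u))) with (Ci * (PI * u * sinhc (PI * u))).
  - replace (- (1) * (2 * PI * z * (Ci / 2 + u))) with (- (2 * PI * z * (Ci / 2 + u))) by ring.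
    field; auto.
  - rewrite sinhc_spec; unfold Ccosh.
    replace (PI * (Ci / 2 + u)) with (PI / 2 * Ci + PI * u) by field.
    replace (- (PI / 2 * Ci + PI * u)) with (- (PI / 2 * Ci) + - (PI * u)) by ring.
    rewrite !Cexp_plus, (Cexp_opp (PI / 2 * Ci)), Cexp_PI2.
    replace (/ Ci) with (- Ci) by (apply injective_projections; simpl; field).
    field.
Qed.

(** Expanding (x + i)^2 produces the cross term - 2 PI tau x in the exponent, which replaces z by z
    + tau, while cosh changes sign. *)
Lemma kernel_shift_i (z tau : R) (x : C) :
  kernel z tau (x + Ci)
  = - (Cexp (- (2 * PI * Ci * z) - PI * Ci * tau) * kernel (z + tau)%R tau x).
Proof.
  assert (Hi : Ci * Ci = - (1)) by (apply injective_projections; simpl; ring).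
  assert (HC : Ccosh (PI * (x + Ci)) = - (1) * Ccosh (PI * x)).
  { unfold Ccosh.
    replace (PI * (x + Ci)) with (PI * x + PI * Ci) by ring.
    replace (- (PI * x + PI * Ci)) with (- (PI * x) + - (PI * Ci)) by ring.
    rewrite !Cexp_plus, (Cexp_opp (PI * Ci)), Cexp_PI.
    replace (/ - (1)) with (- (1)) by field; field. }
  unfold kernel; rewrite HC, RtoC_plus.
  assert (HE : PI * Ci * tau * ((x + Ci) * (x + Ci)) + - (2 * PI * z * (x + Ci))
    = - (2 * PI * Ci * z) - PI * Ci * tau
      + (PI * Ci * tau * (x * x) + - (2 * PI * (z + tau) * x))).
  { transitivity (PI * Ci * tau * (x * x) + 2 * PI * tau * x * (Ci * Ci)
      + PI * Ci * tau * (Ci * Ci) - 2 * PI * z * (x + Ci)); [ring|].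
    rewrite Hi; ring. }
  rewrite HE, Cexp_plus.
  replace (/ (- (1) * Ccosh (PI * x))) with (- / Ccosh (PI * x)); [ring|].
  (* At a zero of cosh both sides are 0, because the inverse of 0 is 0. *)
  destruct (Ceq_dec (Ccosh (PI * x)) 0) as [E|E]; [|now field].
  rewrite E, Cmult_0_r; apply injective_projections; simpl; unfold Rdiv; ring.
Qed.

(** * The functional equations *)

Lemma half_Ci : Ci / 2 = (0, 1 / 2)%R.
Proof. apply injective_projections; simpl; field. Qed.

Lemma Cmod_on_sides_ge (Y : R) (w : C) :
  (1 <= Y)%R -> on_sides (- (Ci / 2)) omega Ci Y w -> (1 / 4 <= Cmod w)%R.
Proof.
  intros HY [y Hw]; pose proof rsqrt2_bounds.
  pose proof (Cmod2_alt w) as H2; pose proof (Cmod_ge_0 w) as H0.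
  assert (Hs : (1 / 16 <= Re w ^ 2 + Im w ^ 2)%R).
  { rewrite half_Ci, omega_eq in Hw.
    assert (HdY : (1 / 2 <= rsqrt2 * Y)%R) by nra.
    destruct Hw as [->|[->|[->| ->]]]; match goal with |- (_ <= Re ?w ^ 2 + Im ?w ^ 2)%R =>
      pose proof (pow2_ge_0 (Im w)) end.
    - replace (Re _) with (rsqrt2 * y)%R by (simpl; ring).
      replace (Im _) with (rsqrt2 * y - 1 / 2)%R by (simpl; ring).
      pose proof (pow2_ge_0 (rsqrt2 * y - 1 / 4)); nra.
    - replace (Re _) with (rsqrt2 * y)%R by (simpl; ring).
      replace (Im _) with (rsqrt2 * y + 1 / 2)%R by (simpl; field).
      pose proof (pow2_ge_0 (rsqrt2 * y + 1 / 4)); nra.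
    - replace (Re _) with (rsqrt2 * Y)%R by (simpl; ring); nra.
    - replace (Re _) with (- (rsqrt2 * Y))%R by (simpl; ring); nra. }
  destruct (Rle_lt_dec (1 / 4) (Cmod w)) as [L|L]; [exact L|nra].
Qed.

(** The long sides cross the imaginary axis at i/2 - s i/2 and i/2 + s i/2. For 0 < s < 2 these
    points avoid the pole i/2 and stop short of its neighbours - i/2 and 3i/2, which are reached at
    s = 2; the short sides never meet the axis. *)
Lemma Ccosh_on_sides_neq_0 (Y s : R) (w : C) :
  (0 < Y)%R -> (0 < s < 2)%R -> on_sides (- (Ci / 2)) omega Ci Y w ->
  Ccosh (PI * (Ci / 2 + s * w)) <> 0.
Proof.
  intros HY Hs [y Hw]; pose proof rsqrt2_pos as Hd; pose proof PI_RGT_0 as Hpi.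
  assert (Hps : (0 < PI * s)%R) by nra.
  apply Ccosh_neq_0; intros E.
  assert (Er : Re w = 0%R).
  { rewrite half_Ci in E; simpl in E.
    assert (E' : (PI * s * Re w = 0)%R) by (unfold Re; lra).
    apply Rmult_integral in E'; destruct E' as [E'|E']; [lra|exact E']. }
  replace (Im (PI * (Ci / 2 + s * w))) with (PI / 2 + PI * s * Im w)%R
    by (rewrite half_Ci; simpl; unfold Im; field).
  rewrite half_Ci, omega_eq in Hw.
  destruct Hw as [->|[->|[->| ->]]]; simpl in *.
  - assert (Ey : (rsqrt2 * y = 0)%R) by lra.
    apply Rgt_not_eq, cos_gt_0; nra.
  - assert (Ey : (rsqrt2 * y = 0)%R) by lra.
    apply Rlt_not_eq, cos_lt_0; nra.
  - nra.
  - nra.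
Qed.

Lemma mordell_pos_shift_tau (z tau : R) : (0 < tau)%R ->
  mordell_pos z tau
  + Cexp (- (2 * PI * Ci * z) - PI * Ci * tau) * mordell_pos (z + tau)%R tau
  = 2 * Cexp (- (PI * Ci * z) - PI * Ci * tau / 4).
Proof.
  intros Ht.
  (* Moving the pole to the origin puts the lower side on [omega] R and the upper one on [omega] R +
     Ci. The upper side is subtracted, and the minus sign of [kernel_shift_i] turns this into a
     sum. *)
  set (f := fun u => kernel z tau (Ci / 2 + u)).
  set (k := Cexp (- (2 * PI * Ci * z) - PI * Ci * tau)).
  set (rho := Cexp (- (PI * Ci * z) - PI * Ci * tau / 4) / (PI * Ci)).
  destruct (holo_on_kernel (fun u => Ccosh (PI * (Ci / 2 + u)) <> 0) z tau (fun u => Ci / 2 + u))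
    as [f' Hf].
  { auto. }
  { apply holo_on_plus; [apply holo_on_const|apply holo_on_id]. }
  fold f in Hf.
  assert (Hs : forall Y s w, (1 < Y)%R -> (0 < s < 2)%R ->
    on_sides (- (Ci / 2)) omega Ci Y w -> holo f f' (s * w)).
  { intros Y s w HY Hs Hw; apply Hf, (Ccosh_on_sides_neq_0 Y); auto; lra. }
  assert (HR : forall Y, (1 < Y)%R ->
    quad f (- (Ci / 2)) omega Ci Y 1 = rho * quad Cinv (- (Ci / 2)) omega Ci Y 1).
  { intros Y HY; apply (quad_residue f f' rho _ _ _ Y (1 / 4)); try lra.
    - intros w; apply Cmod_on_sides_ge; lra.
    - intros s w; now apply Hs.
    - intros e; apply kernel_residue. }
  assert (HL : forall Y, (1 < Y)%R -> quad f (- (Ci / 2)) omega Ci Y 1 =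
    mordell_part z tau Y + k * mordell_part (z + tau) tau Y + line f (- (Ci / 2) + omega * Y) Ci 0 1
    + - (1) * line f (- (Ci / 2) - omega * Y) Ci 0 1).
  { intros Y HY; unfold quad; rewrite !Cmult_1_l.
    assert (L1 : line f (- (Ci / 2)) omega (- Y) Y = mordell_part z tau Y).
    { rewrite <- line_kernel; apply (RInt_ext (V := C_R_CompleteNormedModule)).
      intros y _; unfold f; do 2 f_equal; ring. }
    assert (L2 : line f (- (Ci / 2) + Ci) omega (- Y) Y = - k * mordell_part (z + tau) tau Y).
    { rewrite <- line_kernel.
      rewrite <- (is_CRInt_unique _ _ _ _ (is_CRInt_mult_l (- k) _ _ _ _
        (CRInt_correct (fun y : R => kernel (z + tau) tau (omega * y) * omega) (- Y) Y
           ltac:(intros y; apply continuous_Cmult;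
                 [apply continuous_kernel_omega|apply continuous_const])))).
      apply (RInt_ext (V := C_R_CompleteNormedModule)).
      intros y _; unfold f.
      replace (Ci / 2 + (- (Ci / 2) + Ci + omega * y)) with (omega * y + Ci) by ring.
      rewrite kernel_shift_i; fold k; Cring. }
    rewrite L1, L2; ring. }
  (* The right and the left short side are the cases sg = 1 and sg = -1. *)
  assert (HS : forall (sg : R), Rabs sg = 1%R ->
    lim_infty (fun Y => line f (- (Ci / 2) + omega * (sg * Y)%R) Ci 0 1) 0).
  { intros sg Hsg.
    apply (lim_infty_bound 1 _ _ (fun Y => kernel_bound z tau * exp (- Y))%R);
      [apply is_lim_exp_opp|]; intros Y HY.
    replace (_ - 0) with (line f (- (Ci / 2) + omega * (sg * Y)%R) Ci 0 1) by ring.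
    replace (kernel_bound z tau * exp (- Y))%R
      with ((1 - 0) * (kernel_bound z tau * exp (- Y)))%R by ring.
    assert (Hsd : forall y : R, on_sides (- (Ci / 2)) omega Ci Y
      (- (Ci / 2) + omega * (sg * Y)%R + Ci * y)).
    { intros y; exists y; unfold Rabs in Hsg; destruct (Rcase_abs sg).
      - right; right; right; replace sg with (- (1))%R by lra.
        rewrite RtoC_mult, RtoC_opp; ring.
      - right; right; left; replace sg with 1%R by lra; rewrite Rmult_1_l; ring. }
    apply Cmod_CRInt_le; [lra| |].
    - intros y; apply continuous_line; rewrite <- Cmult_1_l.
      apply (Hs Y 1%R); [exact HY|lra|apply Hsd].
    - intros t Ht1; rewrite Cmod_mult, Cmod_Ci, Rmult_1_r; unfold f.
      replace (Ci / 2 + (- (Ci / 2) + omega * (sg * Y)%R + Ci * t))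
        with (omega * (sg * Y)%R + Ci * t) by ring.
      assert (HA : Rabs (sg * Y) = Y)
        by (rewrite Rabs_mult, Hsg, Rabs_pos_eq by lra; ring).
      rewrite <- HA at 2; apply Cmod_kernel_le; auto; lra. }
  assert (Lim1 : lim_infty (fun Y => quad f (- (Ci / 2)) omega Ci Y 1)
    (mordell_pos z tau + k * mordell_pos (z + tau)%R tau + 0 + - (1) * 0)).
  { apply (lim_infty_ext 1 _ _ _ (fun Y HY => eq_sym (HL Y HY))).
    apply lim_infty_plus; [apply lim_infty_plus; [apply lim_infty_plus|]|].
    - now apply mordell_part_lim.
    - now apply lim_infty_mult_l, mordell_part_lim.
    - apply (lim_infty_ext 1 (fun Y => line f (- (Ci / 2) + omega * (1 * Y)%R) Ci 0 1)).
      + intros Y _; now rewrite Rmult_1_l.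
      + apply HS, Rabs_R1.
    - apply lim_infty_mult_l.
      apply (lim_infty_ext 1 (fun Y => line f (- (Ci / 2) + omega * (- (1) * Y)%R) Ci 0 1)).
      + intros Y _; f_equal; rewrite RtoC_mult, RtoC_opp; ring.
      + apply HS; rewrite Rabs_Ropp; apply Rabs_R1. }
  assert (Lim2 : lim_infty (fun Y => quad f (- (Ci / 2)) omega Ci Y 1)
    (rho * (2 * PI * Ci))).
  { apply (lim_infty_ext 1 _ _ _ (fun Y HY => eq_sym (HR Y HY))).
    apply lim_infty_mult_l, quad_inv_lim. }
  pose proof (lim_infty_unique _ _ _ Lim1 Lim2) as H.
  transitivity (mordell_pos z tau + k * mordell_pos (z + tau)%R tau + 0 + - (1) * 0);
    [ring|].
  rewrite H; unfold rho; field; split.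
  - intros E; injection E as E; lra.
  - intros E; apply RtoC_inj in E; pose proof PI_RGT_0; lra.
Qed.

(** * Translation by 1 and the Gaussian integral *)

Definition gauss_cosh (z tau y : R) : C :=
  Cexp (- (PI * tau) * (y * y)) * Ccosh (2 * PI * z * omega * y).

Lemma continuous_gauss_cosh (z tau y : R) : continuous (gauss_cosh z tau) y.
Proof.
  unfold gauss_cosh; apply continuous_Cmult; [apply continuous_Cexp; Ccont|].
  apply (continuous_comp (fun y : R => 2 * PI * z * omega * y) Ccosh);
    [Ccont|apply continuous_Ccosh].
Qed.

(** The addition formula cosh (a + b) + cosh (a - b) = 2 cosh a cosh b, with b the argument of the
    denominator. Shifting by 1/2 on both sides of z makes the formula apply directly. *)
Lemma mordell_integrand_shift_half (z tau y : R) :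
  mordell_integrand (z + 1 / 2) tau y + mordell_integrand (z - 1 / 2) tau y
  = 2 * gauss_cosh z tau y.
Proof.
  unfold mordell_integrand, gauss_cosh; fold omega.
  rewrite <- Cexp_RtoC.
  replace (RtoC (- PI * tau * y ^ 2)) with (- (PI * tau) * (y * y))
    by (rewrite !RtoC_mult, RtoC_opp, RtoC_pow; ring).
  replace (PI * omega * y) with (PI * (omega * y)) by ring.
  transitivity (Cexp (- (PI * tau) * (y * y)) *
    ((Ccosh (2 * PI * (z + 1 / 2)%R * omega * y)
      + Ccosh (2 * PI * (z - 1 / 2)%R * omega * y)) / Ccosh (PI * (omega * y))));
    [field; apply Ccosh_omega_neq_0|].
  replace (Ccosh (2 * PI * (z + 1 / 2)%R * omega * y)
      + Ccosh (2 * PI * (z - 1 / 2)%R * omega * y))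
    with (2 * Ccosh (2 * PI * z * omega * y) * Ccosh (PI * (omega * y))).
  { field; apply Ccosh_omega_neq_0. }
  rewrite RtoC_plus, RtoC_minus, RtoC_div by lra.
  unfold Ccosh.
  replace (2 * PI * (z + 1 / 2) * omega * y)
    with (2 * PI * z * omega * y + PI * (omega * y)) by field.
  replace (2 * PI * (z - 1 / 2) * omega * y)
    with (2 * PI * z * omega * y + - (PI * (omega * y))) by field.
  generalize (2 * PI * z * omega * y) (PI * (omega * y)); intros a b.
  replace (- (a + b)) with (- a + - b) by ring.
  replace (- (a + - b)) with (- a + b) by ring.
  rewrite !Cexp_plus; field.
Qed.

Lemma mordell_part_shift_half (z tau Y : R) :
  mordell_part (z + 1 / 2) tau Y + mordell_part (z - 1 / 2) tau Y = 4 * omega * CRInt (gauss_cosh z tau) 0 Y.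
Proof.
  unfold mordell_part.
  assert (H : is_CRInt (fun y => 2 * gauss_cosh z tau y) 0 Y
    (CRInt (mordell_integrand (z + 1 / 2) tau) 0 Y
     + CRInt (mordell_integrand (z - 1 / 2) tau) 0 Y)).
  { apply (is_RInt_ext (V := C_R_NormedModule) (fun y =>
      plus (mordell_integrand (z + 1 / 2) tau y : C_R_NormedModule)
           (mordell_integrand (z - 1 / 2) tau y))).
    - intros y _; apply mordell_integrand_shift_half.
    - apply (is_RInt_plus (V := C_R_NormedModule));
        apply CRInt_correct, continuous_mordell_integrand. }
  apply is_CRInt_unique in H.
  rewrite (is_CRInt_unique _ _ _ _ (is_CRInt_mult_l 2 _ _ _ _
    (CRInt_correct _ 0 Y (continuous_gauss_cosh z tau)))) in H.
  transitivity (2 * omega * (CRInt (mordell_integrand (z + 1 / 2) tau) 0 Y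
     + CRInt (mordell_integrand (z - 1 / 2) tau) 0 Y)); [ring|].
  rewrite <- H; ring.
Qed.

Definition gauss (tau : R) (u : C) : C := Cexp (- (PI * tau) * (u * u)).

Lemma holo_gauss (tau : R) : exists g', forall u, holo (gauss tau) g' u.
Proof.
  assert (H : holo_on (fun _ => True) (gauss tau)).
  { apply holo_on_Cexp, holo_on_mult; [apply holo_on_const|].
    apply holo_on_mult; apply holo_on_id. }
  destruct H as [g' H]; exists g'; auto.
Qed.

(** Completing the square: up to a constant, [gauss_cosh z] is the even part of the plain Gaussian
    on the real line displaced by - (z / tau) omega. *)
Lemma gauss_shift (z tau y : R) : tau <> 0%R ->
  gauss tau (- (z / tau)%R * omega + y) + gauss tau (- (z / tau)%R * omega + (- y)%R)
  = 2 * Cexp (- (PI * Ci * (z * z) / tau)) * gauss_cosh z tau y.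
Proof.
  intros Ht; assert (Ht' : RtoC tau <> 0) by (intros H; now apply RtoC_inj in H).
  unfold gauss, gauss_cosh, Ccosh.
  rewrite RtoC_opp, RtoC_div by exact Ht.
  replace (- (PI * tau) * ((- (z / tau) * omega + y) * (- (z / tau) * omega + y)))
    with (- (PI * (omega * omega) * (z * z) / tau) + - (PI * tau) * (y * y)
          + 2 * PI * z * omega * y) by (field; exact Ht').
  replace (- (PI * tau) * ((- (z / tau) * omega + - y) * (- (z / tau) * omega + - y)))
    with (- (PI * (omega * omega) * (z * z) / tau) + - (PI * tau) * (y * y)
          + - (2 * PI * z * omega * y)) by (field; exact Ht').
  rewrite omega_sqr, !Cexp_plus; field.
Qed.

Lemma Cmod_gauss_le (tau c sg Y t : R) :
  (0 < tau)%R -> (0 <= t <= 1)%R -> (0 < Y)%R -> Rabs sg = 1%R ->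
  (Cmod (gauss tau ((sg * Y)%R + c * omega * t))
   <= exp ((2 * PI * tau * Rabs c + 1) ^ 2 / (4 * (PI * tau))) * exp (- Y))%R.
Proof.
  intros Ht Ht1 HY Hsg; pose proof rsqrt2_bounds as Hd; pose proof PI_RGT_0 as Hpi.
  unfold gauss; rewrite Cmod_Cexp, <- exp_plus; apply exp_le_mono.
  set (K := (2 * PI * tau * Rabs c)%R).
  apply Rle_trans with (- (PI * tau) * Y ^ 2 + K * Y)%R;
    [|apply Rle_trans with (1 := gauss_le (PI * tau) K Y ltac:(nra)); lra].
  replace (Re _) with
    (- (PI * tau) * ((sg * sg) * (Y * Y)) + 2 * (PI * tau) * (rsqrt2 * t) * Y * (- (sg * c)))%R
    by (rewrite omega_eq; simpl; ring).
  assert (Hs2 : (sg * sg = 1)%R)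
    by (unfold Rabs in Hsg; destruct (Rcase_abs sg); nra).
  assert (Hc : (- (sg * c) <= Rabs c)%R).
  { rewrite <- (Rmult_1_l (Rabs c)), <- Hsg, <- Rabs_mult, <- Rabs_Ropp; apply Rle_abs. }
  rewrite Hs2; unfold K.
  assert (H0 : (0 <= PI * tau * Y)%R) by (apply Rmult_le_pos; nra).
  assert (H1 : (0 <= rsqrt2 * t <= 1)%R) by (split; nra).
  pose proof (Rabs_pos c) as Hc0.
  assert (H2 : (rsqrt2 * t * - (sg * c) <= Rabs c)%R) by nra.
  assert (H3 : (PI * tau * Y * (rsqrt2 * t * - (sg * c)) <= PI * tau * Y * Rabs c)%R)
    by (apply Rmult_le_compat_l; assumption).
  simpl; lra.
Qed.

Definition mordell_sum (z tau : R) : C :=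
  mordell_pos (z + 1 / 2) tau + mordell_pos (z - 1 / 2) tau.

Lemma mordell_sum_lim (z tau : R) : (0 < tau)%R ->
  lim_infty (fun Y => 4 * omega * CRInt (gauss_cosh z tau) 0 Y) (mordell_sum z tau).
Proof.
  intros Ht.
  apply (lim_infty_ext 0 _ _ _ (fun Y _ => mordell_part_shift_half z tau Y)).
  apply lim_infty_plus; now apply mordell_part_lim.
Qed.

(** The Gaussian is entire, so its integral is the same over the real line and over the parallel
    line through - (z / tau) omega; the sides joining the two lines at distance Y decay. *)
Lemma mordell_sum_0 (z tau : R) : (0 < tau)%R ->
  mordell_sum 0 tau = Cexp (- (PI * Ci * (z * z) / tau)) * mordell_sum z tau.
Proof.
  intros Ht; destruct (holo_gauss tau) as [g' Hg].
  set (c := (- (z / tau))%R); set (k := Cexp (- (PI * Ci * (z * z) / tau))).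
  assert (Cg : forall (p q : C) (y : R), continuous (fun y : R => gauss tau (p + q * y)) y).
  { intros p q y; apply (continuous_comp (fun y : R => p + q * y) (gauss tau)); [Ccont|].
    apply (proj1 (Hg _)). }
  assert (N : forall z Y : R, is_CRInt (fun y => 2 * Cexp (- (PI * Ci * (z * z) / tau)) * gauss_cosh z tau y)
    0 Y (2 * Cexp (- (PI * Ci * (z * z) / tau)) * CRInt (gauss_cosh z tau) 0 Y)).
  { intros z' Y; apply is_CRInt_mult_l, CRInt_correct, continuous_gauss_cosh. }
  assert (L : forall z' Y : R, line (gauss tau) (- (z' / tau)%R * omega) 1 (- Y) Y
    = 2 * Cexp (- (PI * Ci * (z' * z') / tau)) * CRInt (gauss_cosh z' tau) 0 Y).
  { intros z' Y; unfold line.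
    rewrite <- (is_CRInt_unique _ _ _ _ (N z' Y)).
    apply CRInt_symmetric.
    - intros y; apply continuous_Cmult; [apply Cg|apply continuous_const].
    - intros y; rewrite <- gauss_shift by lra; rewrite !Cmult_1_l, !Cmult_1_r; reflexivity. }
  assert (HS : forall sg : R, Rabs sg = 1%R ->
    lim_infty (fun Y => line (gauss tau) (sg * Y)%R (c * omega) 0 1) 0).
  { intros sg Hsg.
    set (K := (exp ((2 * PI * tau * Rabs c + 1) ^ 2 / (4 * (PI * tau))) * Cmod (c * omega))%R).
    apply (lim_infty_bound 0 _ _ (fun Y => K * exp (- Y))%R);
      [apply is_lim_exp_opp|]; intros Y HY.
    replace (_ - 0) with (line (gauss tau) (sg * Y)%R (c * omega) 0 1) by ring.
    replace (K * exp (- Y))%R with ((1 - 0) * (K * exp (- Y)))%R by ring.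
    apply Cmod_CRInt_le; [lra| |].
    - intros y; apply continuous_Cmult; [apply Cg|apply continuous_const].
    - intros t Ht1; rewrite Cmod_mult; unfold K.
      eapply Rle_trans.
      + apply Rmult_le_compat_r; [apply Cmod_ge_0|].
        now apply (Cmod_gauss_le tau c sg Y t).
      + right; ring. }
  assert (HQ : forall Y : R,
    4 * omega * CRInt (gauss_cosh 0 tau) 0 Y
    + (2 * omega * line (gauss tau) (1 * Y)%R (c * omega) 0 1
       + - (2 * omega) * line (gauss tau) (- (1) * Y)%R (c * omega) 0 1)
    = k * (4 * omega * CRInt (gauss_cosh z tau) 0 Y)).
  { intros Y; pose proof (quad_entire (gauss tau) g' 0 1 (c * omega) Y Hg) as Q.
    unfold quad in Q; rewrite !Cmult_1_l, !Cplus_0_l in Q.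
    (* The real line is written as the displaced line for z = 0, so that [L] evaluates both long
       sides. *)
    replace (RtoC 0) with (- (0 / tau)%R * omega) in Q at 1
      by (unfold Rdiv; rewrite Rmult_0_l; ring).
    replace (c * omega) with (- (z / tau)%R * omega) in Q at 2
      by (unfold c; now rewrite RtoC_opp).
    rewrite !L in Q.
    replace (- (PI * Ci * (0 * 0) / tau)) with (RtoC 0) in Q
      by (unfold Cdiv; ring).
    rewrite Cexp_0 in Q; fold k in Q.
    rewrite Rmult_1_l; replace (RtoC (- (1) * Y)) with (0 - Y)
      by (rewrite RtoC_mult, RtoC_opp; ring).
    apply Cminus_eq_0.
    match type of Q with ?q = _ => transitivity (2 * omega * q) end;
      [ring|rewrite Q; ring]. }
  assert (L1 := lim_infty_mult_l k _ _ (mordell_sum_lim z tau Ht)).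
  assert (L2 := lim_infty_plus _ _ _ _ (mordell_sum_lim 0 tau Ht)
    (lim_infty_plus _ _ _ _
      (lim_infty_mult_l (2 * omega) _ _ (HS 1%R Rabs_R1))
      (lim_infty_mult_l (- (2 * omega)) _ _
        (HS (- (1))%R (eq_trans (Rabs_Ropp 1) Rabs_R1))))).
  apply (lim_infty_ext 0 _ _ _ (fun Y _ => HQ Y)) in L2.
  rewrite <- (lim_infty_unique _ _ _ L2 L1); ring.
Qed.

(* The Gaussian integral comes for free: at tau = 1 and z = -1/2 the shift by
   tau is also a shift by 1, so the residue relation evaluates mordell_sum. *)
Lemma mordell_sum_0_1 : mordell_sum 0 1 = 2 * omega.
Proof.
  pose proof (mordell_pos_shift_tau (- (1 / 2)) 1 Rlt_0_1) as H.
  rewrite RtoC_opp, RtoC_div in H by lra.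
  replace (- (2 * PI * Ci * - (1 / 2)) - PI * Ci * 1) with (RtoC 0) in H by field.
  replace (- (PI * Ci * - (1 / 2)) - PI * Ci * 1 / 4) with (PI * Ci / 4) in H by field.
  rewrite Cexp_0 in H; fold omega in H.
  unfold mordell_sum; rewrite <- H.
  replace (0 + 1 / 2)%R with (- (1 / 2) + 1)%R by field.
  replace (0 - 1 / 2)%R with (- (1 / 2))%R by ring; ring.
Qed.

(** The substitution of sqrt tau y for y; it reduces every tau to the known value at tau = 1. *)
Lemma mordell_sum_0_scale (tau : R) : (0 < tau)%R ->
  sqrt tau * mordell_sum 0 tau = mordell_sum 0 1.
Proof.
  intros Ht.
  assert (Hs : (0 < sqrt tau)%R) by now apply sqrt_lt_R0.
  assert (E : forall Y : R, sqrt tau * (4 * omega * CRInt (gauss_cosh 0 tau) 0 Y)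
    = 4 * omega * CRInt (gauss_cosh 0 1) 0 (sqrt tau * Y)).
  { intros Y.
    assert (H : is_CRInt (gauss_cosh 0 1) (sqrt tau * 0 + 0) (sqrt tau * Y + 0)
      (CRInt (gauss_cosh 0 1) 0 (sqrt tau * Y))).
    { rewrite Rmult_0_r, !Rplus_0_r; apply CRInt_correct, continuous_gauss_cosh. }
    apply (is_RInt_comp_lin (V := C_R_NormedModule)) in H.
    apply (is_RInt_ext (V := C_R_NormedModule) _ (fun y => sqrt tau * gauss_cosh 0 tau y)) in H.
    - apply is_CRInt_unique in H.
      rewrite (is_CRInt_unique _ _ _ _ (is_CRInt_mult_l (sqrt tau) _ _ _ _
        (CRInt_correct _ 0 Y (continuous_gauss_cosh 0 tau)))) in H.
      rewrite <- H; ring.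
    - intros y _; rewrite scal_R_Cmult; f_equal; unfold gauss_cosh.
      rewrite Rplus_0_r.
      replace (2 * PI * 0 * omega * (sqrt tau * y)%R) with (RtoC 0) by ring.
      replace (2 * PI * 0 * omega * y) with (RtoC 0) by ring.
      f_equal; f_equal.
      rewrite <- !RtoC_mult, <- !RtoC_opp, <- !RtoC_mult; f_equal.
      rewrite <- (sqrt_sqrt tau) at 3 by lra; ring. }
  assert (L1 := lim_infty_mult_l (sqrt tau) _ _ (mordell_sum_lim 0 tau Ht)).
  apply (lim_infty_ext 0 _ _ _ (fun Y _ => E Y)) in L1.
  apply (lim_infty_unique _ _ _ L1).
  apply (filterlim_comp _ _ _ (fun Y => sqrt tau * Y)%R
    (fun Y => 4 * omega * CRInt (gauss_cosh 0 1) 0 Y) _ (Rbar_locally p_infty));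
    [|apply mordell_sum_lim, Rlt_0_1].
  intros P [N HN]; exists (N / sqrt tau)%R; intros Y HY; apply HN.
  apply Rlt_div_l in HY; [lra|exact Hs].
Qed.

Lemma mordell_sum_eq (z tau : R) : (0 < tau)%R ->
  mordell_sum z tau = 2 * omega / sqrt tau * Cexp (PI * Ci * (z * z) / tau).
Proof.
  intros Ht.
  assert (Hs : RtoC (sqrt tau) <> 0)
    by (intros H; apply RtoC_inj in H; pose proof (sqrt_lt_R0 tau Ht); lra).
  pose proof (mordell_sum_0 z tau Ht) as H1.
  pose proof (mordell_sum_0_scale tau Ht) as H2.
  rewrite mordell_sum_0_1, H1, Cexp_opp in H2.
  rewrite <- H2; field; split; [apply Cexp_neq_0|exact Hs].
Qed.

(** * The truncated theta function *)

(** With real arguments, identities between products of exponentials become identities of real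
    numbers through [phase_plus], and conjugation is a change of sign. *)
Definition phase (x : R) : C := Cexp (PI * Ci * x).

Lemma phase_plus (x y : R) : phase (x + y) = phase x * phase y.
Proof. unfold phase; rewrite <- Cexp_plus, RtoC_plus; f_equal; ring. Qed.

Lemma phase_0 : phase 0 = 1.
Proof. unfold phase; rewrite Cmult_0_r; apply Cexp_0. Qed.

Lemma phase_conj (x : R) : Cconj (phase x) = phase (- x).
Proof.
  unfold phase; rewrite Cexp_conj; f_equal.
  apply injective_projections; simpl; ring.
Qed.

Lemma phase_nat (k : nat) : phase (INR k) = (- (1)) ^ k.
Proof. unfold phase; rewrite <- Cexp_nat_PI; f_equal; ring. Qed.

Definition hneg (z tau : R) : C := Cconj (mordell_pos z (2 * tau)).

Lemma h_neg (z tau : R) : (0 < tau)%R -> h z (- 2 * tau) = hneg z tau.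
Proof.
  intros Ht; unfold h, hneg; destruct (Rlt_dec 0 (- 2 * tau)) as [L|L]; [lra|].
  do 2 f_equal; ring.
Qed.

Lemma hneg_shift_1 (z tau : R) : (0 < tau)%R ->
  hneg (z + 1 / 2) tau + hneg (z - 1 / 2) tau
  = - (2 * Ci * omega) * / sqrt (2 * tau) * phase (- (z * z / (2 * tau))).
Proof.
  intros Ht.
  assert (Hs : RtoC (sqrt (2 * tau)) <> 0).
  { intros H; apply RtoC_inj in H.
    pose proof (sqrt_lt_R0 (2 * tau) ltac:(lra)); lra. }
  assert (H := mordell_sum_eq z (2 * tau) ltac:(lra)).
  apply (f_equal Cconj) in H; unfold mordell_sum in H; rewrite Cplus_conj in H.
  unfold hneg; rewrite H.
  replace (PI * Ci * (z * z) / RtoC (2 * tau)) with (PI * Ci * RtoC (z * z / (2 * tau))).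
  2:{ rewrite RtoC_div, (RtoC_mult z z) by lra; unfold Cdiv; ring. }
  fold (phase (z * z / (2 * tau))).
  rewrite Cmult_conj, Cdiv_conj, Cmult_conj, omega_conj, phase_conj by exact Hs.
  replace (Cconj 2) with (RtoC 2) by (apply injective_projections; simpl; ring).
  replace (Cconj (sqrt (2 * tau))) with (RtoC (sqrt (2 * tau)))
    by (apply injective_projections; simpl; ring).
  unfold Cdiv; ring.
Qed.

Lemma hneg_shift_2tau (z tau : R) : (0 < tau)%R ->
  hneg z tau + phase (2 * z + 2 * tau) * hneg (z + 2 * tau) tau = 2 * phase (z + tau / 2).
Proof.
  intros Ht.
  assert (H := mordell_pos_shift_tau z (2 * tau) ltac:(lra)).
  apply (f_equal Cconj) in H.
  replace (- (2 * PI * Ci * z) - PI * Ci * RtoC (2 * tau))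
    with (PI * Ci * RtoC (- (2 * z + 2 * tau))) in H
    by (rewrite RtoC_opp, RtoC_plus, !RtoC_mult; ring).
  replace (- (PI * Ci * z) - PI * Ci * RtoC (2 * tau) / 4)
    with (PI * Ci * RtoC (- (z + tau / 2))) in H
    by (rewrite RtoC_opp, RtoC_plus, RtoC_mult, RtoC_div by lra; field).
  fold (phase (- (2 * z + 2 * tau))) (phase (- (z + tau / 2))) in H.
  rewrite Cplus_conj, !Cmult_conj, !phase_conj, !Ropp_involutive in H.
  replace (Cconj 2) with (RtoC 2) in H by (apply injective_projections; simpl; ring).
  exact H.
Qed.

Lemma F_0 (z tau : R) : F 0 z tau = 1.
Proof.
  unfold F; rewrite sum_O; simpl INR.
  replace (2 * PI * Ci * (z * 0 + tau * 0 ^ 2)) with (RtoC 0) by (simpl; ring).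
  apply Cexp_0.
Qed.

Lemma F_S (n : nat) (z tau : R) :
  F (S n) z tau
  = F n z tau + phase (2 * (z * (INR n + 1) + tau * ((INR n + 1) * (INR n + 1)))).
Proof.
  unfold F; rewrite sum_Sn.
  match goal with |- plus ?a (Cexp ?b) = _ => change (a + Cexp b
    = a + phase (2 * (z * (INR n + 1) + tau * ((INR n + 1) * (INR n + 1))))) end.
  f_equal; unfold phase; f_equal; rewrite S_INR.
  rewrite !RtoC_mult, !RtoC_plus, !RtoC_mult, !RtoC_plus; ring.
Qed.

Lemma Rem_eq (m n : nat) (z tau : R) : (0 < tau)%R ->
  Rem m n z tau =
  - (Ci / 2) * phase (- (z - tau / 2)) * hneg (z - tau + 1 / 2) tau
  - (Ci / 2) * (- (1)) ^ m
    * phase (2 * (INR n + 1 / 2) * (z + tau * (INR n + 1 / 2)))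
    * hneg (z + (2 * INR n + 1) * tau - INR m - 1 / 2) tau.
Proof.
  intros Ht; unfold Rem; rewrite !h_neg by exact Ht.
  assert (K : forall (c : C) (x : R), c = PI * Ci * x -> Cexp c = phase x)
    by (intros c x ->; reflexivity).
  rewrite (K (- (PI * Ci * (z - tau / 2))) (- (z - tau / 2))%R),
    (K (2 * PI * Ci * (INR n + 1 / 2) * (z + tau * (INR n + 1 / 2)))
       (2 * (INR n + 1 / 2) * (z + tau * (INR n + 1 / 2)))%R).
  - replace (RtoC (-1)) with (- (1)) by (apply injective_projections; simpl; ring).
    reflexivity.
  - rewrite !RtoC_mult, !RtoC_plus, RtoC_mult, RtoC_plus, RtoC_div by lra; field.
  - rewrite RtoC_opp, RtoC_minus, RtoC_div by lra; field.
Qed.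

Theorem theorem1 (tau z : R) (m n : nat) (htau : (0 < tau)%R) :
  F n z tau =
  (Cexp (PI * Ci / 4 - PI * Ci * z ^ 2 / (2 * tau)) / RtoC (sqrt (2 * tau))
     * F m (z / (2 * tau))%R (- (1 / (4 * tau)))%R
   + Rem m n z tau)%C.
Proof.
  rewrite Rem_eq by exact htau.
  assert (Hpre : Cexp (PI * Ci / 4 - PI * Ci * z ^ 2 / (2 * tau)) / RtoC (sqrt (2 * tau))
    = omega * / RtoC (sqrt (2 * tau)) * phase (- (z * z / (2 * tau)))).
  { replace (PI * Ci / 4 - PI * Ci * z ^ 2 / (2 * tau))
      with (PI * Ci / 4 + PI * Ci * RtoC (- (z * z / (2 * tau)))).
    - rewrite Cexp_plus; fold omega (phase (- (z * z / (2 * tau)))); unfold Cdiv; ring.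
    - rewrite RtoC_opp, RtoC_div, !RtoC_mult by lra; unfold Cdiv; ring. }
  rewrite Hpre; set (q := / RtoC (sqrt (2 * tau))).
  assert (Hi : Ci * Ci = - (1)) by (apply injective_projections; simpl; ring).
  assert (Hhalf : phase (- (1 / 2)) = - Ci).
  { rewrite <- phase_conj; unfold phase; rewrite RtoC_div by lra.
    replace (PI * Ci * (1 / 2)) with (PI / 2 * Ci) by field.
    rewrite Cexp_PI2; apply injective_projections; simpl; ring. }
  assert (Hm : forall k, (- (1)) ^ k * (- (1)) ^ k = RtoC 1).
  { intros k; rewrite <- Cpow_mult_l.
    replace (- (1) * - (1)) with (RtoC 1) by ring; apply Cpow_1_l. }
  assert (Hopp : forall k, phase (- INR k) = (- (1)) ^ k).
  { intros k; transitivity (phase (- INR k) * ((- (1)) ^ k * (- (1)) ^ k));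
      [rewrite Hm; ring|].
    rewrite <- phase_nat at 1; rewrite Cmult_assoc, <- phase_plus, Rplus_opp_l, phase_0; ring. }
  assert (H1 := fun x => hneg_shift_1 x tau htau); fold q in H1.
  assert (H2 := fun x => hneg_shift_2tau x tau htau).
  (* The step in n holds for every fixed m, so the induction on m is needed only at n = 0. *)
  induction n as [|n IHn].
  - induction m as [|m IHm].
    + rewrite !F_0; simpl INR; simpl Cpow.
      (* The translation by 1 leads from z - tau + 1/2 to z - tau - 1/2, and the translation by 2
         tau from there to z + tau - 1/2. *)
      specialize (H1 (z - tau)%R); specialize (H2 (z - tau - 1 / 2)%R).
      replace (z - tau - 1 / 2 + 2 * tau)%R
        with (z + (2 * 0 + 1) * tau - 0 - 1 / 2)%R in H2 by ring.
      replace (2 * (0 + 1 / 2) * (z + tau * (0 + 1 / 2)))%R with (z + tau / 2)%R by field.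
      set (b := hneg (z + (2 * 0 + 1) * tau - 0 - 1 / 2) tau) in *.
      set (a := hneg (z - tau - 1 / 2) tau) in *.
      set (c := hneg (z - tau + 1 / 2) tau) in *.
      assert (P1 : phase (- (z - tau / 2)) * phase (- ((z - tau) * (z - tau) / (2 * tau)))
        = phase (- (z * z / (2 * tau)))) by (rewrite <- phase_plus; f_equal; field; lra).
      assert (P2 : phase (- (z - tau / 2)) * phase (2 * (z - tau - 1 / 2) + 2 * tau)
        = - phase (z + tau / 2)).
      { rewrite <- phase_plus.
        replace (- (z - tau / 2) + (2 * (z - tau - 1 / 2) + 2 * tau))%R
          with (z + tau / 2 + - (1 / 2) + - (1 / 2))%R by field.
        rewrite !phase_plus, Hhalf.
        transitivity (phase z * phase (tau / 2) * (Ci * Ci)); [ring|rewrite Hi; ring]. }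
      assert (P3 : phase (- (z - tau / 2)) * phase (z - tau - 1 / 2 + tau / 2) = - Ci)
        by (rewrite <- phase_plus, <- Hhalf; f_equal; field).
      set (u := phase (- (z - tau / 2))) in *.
      assert (Hc : c = - (2 * Ci * omega) * q * phase (- ((z - tau) * (z - tau) / (2 * tau))) - a)
        by (rewrite <- H1; ring).
      (* Multiplied by Ci / 2, the residue - 2 Ci becomes the value 1 of [F 0]; the Gaussian term of
         [c] cancels the prefactor in front of the other [F 0]. *)
      assert (Ha : u * a = 2 * - Ci + phase (z + tau / 2) * b).
      { transitivity (u * (a + phase (2 * (z - tau - 1 / 2) + 2 * tau) * b)
          - u * phase (2 * (z - tau - 1 / 2) + 2 * tau) * b); [ring|].
        rewrite H2, P2.
        transitivity (2 * (u * phase (z - tau - 1 / 2 + tau / 2)) + phase (z + tau / 2) * b);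
          [ring|rewrite P3; ring]. }
      rewrite Hc.
      transitivity (omega * q * phase (- (z * z / (2 * tau)))
        + Ci * Ci * omega * q * (u * phase (- ((z - tau) * (z - tau) / (2 * tau))))
        + Ci / 2 * (u * a) - Ci / 2 * phase (z + tau / 2) * b); [|field].
      rewrite P1, Ha, Hi.
      transitivity (- (Ci * Ci)); [rewrite Hi; ring|field].
    + rewrite IHm, F_S.
      set (N := (INR m + 1)%R).
      (* Passing from m to m + 1 lowers the argument of the second Mordell integral by 1, from z +
         tau - N + 1/2 to z + tau - N - 1/2. *)
      specialize (H1 (z + tau - N)%R).
      simpl INR at 1 2 3 5 6 7; rewrite S_INR; fold N.
      replace (z + (2 * 0 + 1) * tau - INR m - 1 / 2)%R
        with (z + tau - N + 1 / 2)%R by (unfold N; field).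
      replace (z + (2 * 0 + 1) * tau - N - 1 / 2)%R
        with (z + tau - N - 1 / 2)%R by ring.
      replace (2 * (0 + 1 / 2) * (z + tau * (0 + 1 / 2)))%R with (z + tau / 2)%R by field.
      (* Expanding the square gives the new term of the dual sum times exp (PI i N) = - (-1)^m; the
         factor (-1)^m of the remainder compensates this sign. *)
      assert (P1 : phase (z + tau / 2) * phase (- ((z + tau - N) * (z + tau - N) / (2 * tau)))
        = - (- (1)) ^ m * (phase (- (z * z / (2 * tau)))
           * phase (2 * (z / (2 * tau) * N + - (1 / (4 * tau)) * (N * N))))).
      { rewrite <- !phase_plus.
        replace (- (- (1)) ^ m) with (phase N)
          by (unfold N; rewrite <- S_INR, phase_nat; simpl; ring).
        rewrite <- phase_plus; f_equal; field; lra. }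
      set (a := hneg (z + tau - N + 1 / 2) tau) in *.
      set (b := hneg (z + tau - N - 1 / 2) tau) in *.
      assert (Ha : a = - (2 * Ci * omega) * q
        * phase (- ((z + tau - N) * (z + tau - N) / (2 * tau))) - b) by (rewrite <- H1; ring).
      rewrite Ha; simpl Cpow; set (em := (- (1)) ^ m) in *.
      set (A := phase (2 * (z / (2 * tau) * N + - (1 / (4 * tau)) * (N * N)))) in *.
      assert (Hem : em * em = 1) by apply Hm.
      set (V := phase (- ((z + tau - N) * (z + tau - N) / (2 * tau)))) in *.
      set (B := phase (- (z * z / (2 * tau)))) in *.
      set (D := phase (z + tau / 2)) in *.
      match goal with |- omega * q * B * ?f + (?r - _) = _ =>
        transitivity (omega * q * B * f + r + Ci * Ci * em * omega * q * (D * V)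
          + Ci / 2 * em * D * b); [field|];
        rewrite P1, Hi;
        transitivity (omega * q * B * f + r + em * em * omega * q * (B * A)
          + Ci / 2 * em * D * b); [ring|rewrite Hem; field] end.
  - rewrite F_S, IHn, S_INR.
    set (N := INR n) in *.
    (* Passing from n to n + 1 raises the argument of the second Mordell integral by 2 tau. *)
    specialize (H2 (z + (2 * N + 1) * tau - INR m - 1 / 2)%R).
    replace (z + (2 * N + 1) * tau - INR m - 1 / 2 + 2 * tau)%R
      with (z + (2 * (N + 1) + 1) * tau - INR m - 1 / 2)%R in H2 by ring.
    set (w := (z + (2 * N + 1) * tau - INR m - 1 / 2)%R) in *.
    set (b := hneg (z + (2 * (N + 1) + 1) * tau - INR m - 1 / 2) tau) in *.
    set (a := hneg w tau) in *.
    set (em := (- (1)) ^ m) in *.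
    assert (Hem : em * em = 1) by apply Hm.
    set (U := phase (2 * (N + 1 / 2) * (z + tau * (N + 1 / 2)))) in *.
    set (V := phase (2 * (N + 1 + 1 / 2) * (z + tau * (N + 1 + 1 / 2)))).
    set (X := phase (2 * (z * (N + 1) + tau * ((N + 1) * (N + 1))))).
    (* The residue is, up to the factor - Ci (-1)^m, the new term [X] of [F]. The coefficient - Ci /
       2 (-1)^m of the remainder turns twice this residue into - X, which cancels it. *)
    assert (P1 : U * phase (w + tau / 2) = - Ci * em * X).
    { unfold U, X, em; rewrite <- Hhalf, <- Hopp, <- !phase_plus.
      f_equal; unfold w; field. }
    assert (P2 : U * phase (2 * w + 2 * tau) = - V).
    { transitivity (phase (- (1 / 2)) * phase (- (1 / 2)) * (phase (- INR m) * phase (- INR m)) * V).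
      - unfold U, V; rewrite <- !phase_plus; f_equal; unfold w; field.
      - rewrite Hhalf, Hopp, Hm; transitivity (Ci * Ci * V); [ring|rewrite Hi; ring]. }
    assert (Ha : U * a = 2 * (- Ci * em * X) + V * b).
    { transitivity (U * (a + phase (2 * w + 2 * tau) * b) - U * phase (2 * w + 2 * tau) * b);
        [ring|].
      rewrite H2, P2.
      transitivity (2 * (U * phase (w + tau / 2)) + V * b); [ring|rewrite P1; ring]. }
    match goal with |- ?f + (?r - _) + X = _ =>
      transitivity (f + r + X - Ci / 2 * em * (U * a)); [field|];
      rewrite Ha;
      transitivity (f + r + X + Ci * Ci * (em * em) * X - Ci / 2 * em * V * b);
      [field|rewrite Hi, Hem; field] end.
Qed.
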